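(* Let $X$ be a separable Banach space which does not contain an isomorphic copy of $\ell_1$. Then the Szlenk index of $X$ equals the $\ell_1^+$-weakly null index of $X$, i.e. $\eta(X)=I^+_w(X)$.
   Context: Trees. A tree is a non-empty partially ordered set $(T,\le)$ such that $\{y\in T:y\le x\}$ is linearly ordered and finite for each $x\in T$; its elements are called nodes. The derived tree is $D(T)=\{x\in T: x<y\text{ for some }y\in T\}$; $T^0=T$, $T^{\alpha+1}=D(T^\alpha)$, $T^\alpha=\bigcap_{\beta<\alpha}T^\beta$ for limit $\alpha$. The order $o(T)$ is the least $\alpha<\omega_1$ with $T^\alpha=\emptyset$ if there is one, and $o(T)=\omega_1$ otherwise. A tree on a set $X$ is a subset of $\bigcup_{n\ge1}X^n$ ordered by $(x_1,\dots,x_m)\le(y_1,\dots,y_n)$ iff $m\le n$ and $x_i=y_i$ for $i\le m$. Tree isomorphism means order isomorphism. The trees $T(\alpha,s)$, $1\le\alpha<\omega_1$: $T(1,s)$ is a countably infinite set of pairwise incomparable nodes; $T(\alpha+1,s)$ is obtained from a countably infinite set of pairwise incomparable nodes by placing after each of them a copy of $T(\alpha,s)$; for limit $\alpha$, one fixes a sequence of successor ordinals $\alpha_n\nearrow\alpha$ and $T(\alpha,s)$ is the disjoint (mutually incomparable) union of copies of $T(\alpha_n,s)$, $n\ge1$. One has $o(T(\alpha,s))=\alpha$. A tree $T$ on a Banach space $X$ is said to be isomorphic to $T(\alpha,s)$ if it is order isomorphic to it and, in addition, $(x_1,\dots,x_k)\in T$, $k\ge 2$, implies $(x_1,\dots,x_{k-1})\in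 T$. If $(z^i)_{i\ge1}$ is the sequence of all initial nodes, $z^i=(y_i)$, or the sequence of all immediate successors $z^i=(x_1,\dots,x_k,y_i)$ of a node $(x_1,\dots,x_k)$, then $(y_i)_{i\ge1}$ is called an $s$-subsequence of $T$ (each such sequence is enumerated by a fixed bijection with $\mathbf N$). A weakly null tree on $X$ is a tree on $X$ isomorphic to $T(\alpha,s)$ for some $1\le\alpha<\omega_1$ all of whose $s$-subsequences are weakly null. $\ell_1^+$-weakly null index. For $K\ge1$, a finite sequence $(x_i)_1^m$ in $X$ is an $\ell_1^+$-$K$-sequence if it is normalized, basic with basis constant at most $K$, and $\frac1K\sum_1^m a_i\le\|\sum_1^m a_ix_i\|$ for all $a_i\ge0$. An $\ell_1^+$-$K$-weakly null tree is a weakly null tree on $X$ each of whose nodes is an $\ell_1^+$-$K$-sequence. $I^+_w(X)=\sup_{K\ge1}\sup\{o(T): T \text{ is an } \ell_1^+\text{-}K\text{-weakly null tree on }X\}$ (with $\sup\emptyset=0$). Szlenk index. For $\varepsilon>0$ let $P_0(\varepsilon)=B_{X^*}$ (closed unit ball of $X^*$); $P_{\alpha+1}(\varepsilon)$ is the set of $f\in B_{X^*}$ for which there is a sequence $(f_m)_1^\infty\subset P_\alpha(\varepsilon)$ with $f_m\to f$ weak$^*$ and $\liminf_m\|f_m-f\|\ge\varepsilon$; $P_\alpha(\varepsilon)=\bigcap_{\beta<\alpha}P_\beta(\varepsilon)$ for limit $\alpha$. Put $\eta(\varepsilon,X)=\sup\{\alpha<\omega_1:P_\alpha(\varepsilon)\ne\emptyset\}$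 (so $\eta(\varepsilon,X)=\omega_1$ if $P_\alpha(\varepsilon)\neq\emptyset$ for all $\alpha<\omega_1$), and $\eta(X)=\sup_{\varepsilon>0}\eta(\varepsilon,X)$. *)

(* Defs.v *)
From HB Require Import structures.
From mathcomp Require Import all_boot all_order all_algebra.
From mathcomp Require Import all_classical all_reals all_analysis.
From mathcomp Require wochoice.

Set Implicit Arguments.
Unset Strict Implicit.
Unset Printing Implicit Defensive.

Import Order.TTheory GRing.Theory Num.Theory.
Import numFieldNormedType.Exports.

Local Open Scope classical_set_scope.
Local Open Scope ring_scope.

(** * Countable ordinals

   [omega1] is the set of all points of a well-ordered uncountable set (here,
   of subsets of [nat]) that have only countably many predecessors.  It is an
   uncountable well-ordered set all of whose proper initial segments are
   countable, so it has order type omega_1; its elements are the ordinals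
   below omega_1. *)

Definition wo_rel : rel (set nat) :=
  projT1 (wochoice.well_ordering_principle (set nat)).

Lemma wo_relP : wochoice.well_order wo_rel.
Proof. exact: projT2 (wochoice.well_ordering_principle (set nat)). Qed.

Definition wo_low (x : set nat) : set (set nat) := [set y | wo_rel y x].

Definition omega1 : Type := {x : set nat | `[< countable (wo_low x) >]}.

HB.instance Definition _ := Choice.on omega1.

Definition omega1_le : rel omega1 := fun a b => wo_rel (sval a) (sval b).

Lemma wo_rel_min (A : set (set nat)) : A !=set0 ->
  exists2 x, A x & forall y, A y -> wo_rel x y.
Proof.
move=> [a Aa]; have [|x [[Ax minx] _]] := @wo_relP (fun x => `[< A x >]).
  by exists a; apply/asboolP.
by exists x => [|y Ay]; [exact/asboolP | apply: minx; apply/asboolP].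
Qed.

Lemma wo_rel_total : total wo_rel.
Proof.
move=> x y; have [|z [->|->] zxy] := @wo_rel_min [set x; y].
- by exists x; left.
- by rewrite zxy //; right.
- by rewrite (zxy x) ?orbT //; left.
Qed.

Lemma wo_rel_refl : reflexive wo_rel.
Proof. by move=> x; have := wo_rel_total x x; rewrite orbb. Qed.

Lemma wo_rel_anti : antisymmetric wo_rel.
Proof.
move=> x y /andP[xy yx].
have [|z [_ zU]] := @wo_relP (fun z => (z == x) || (z == y)).
  by exists x; rewrite unfold_in eqxx.
rewrite -(zU x) ?(zU y) //; split; rewrite ?unfold_in ?eqxx ?orbT //.
  by move=> t /orP[]/eqP->; rewrite ?wo_rel_refl.
by move=> t /orP[]/eqP->; rewrite ?wo_rel_refl.
Qed.

Lemma wo_rel_trans : transitive wo_rel.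
Proof.
move=> y x z xy yz; have [|t] := @wo_rel_min [set x; y; z].
  by exists x; left; left.
case=> [[->|tE]|tE] h; first by apply: h; right.
  have yx : wo_rel y x by rewrite -tE; apply: h; left; left.
  by rewrite -(wo_rel_anti (introT andP (conj yx xy))).
have zy : wo_rel z y by rewrite -tE; apply: h; left; right.
by rewrite (wo_rel_anti (introT andP (conj zy yz))).
Qed.

Lemma omega1_le_refl : reflexive omega1_le.
Proof. by move=> a; exact: wo_rel_refl. Qed.

Lemma omega1_le_anti : antisymmetric omega1_le.
Proof. by move=> a b /wo_rel_anti; exact: val_inj. Qed.

Lemma omega1_le_trans : transitive omega1_le.
Proof. by move=> b a c; exact: wo_rel_trans. Qed.

Lemma omega1_le_total : total omega1_le.
Proof. by move=> a b; exact: wo_rel_total. Qed.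

Fact omega1_display : Order.disp_t. Proof. exact: Order.Disp tt tt. Qed.

HB.instance Definition _ := Order.Le_isPOrder.Build omega1_display omega1
  omega1_le_refl omega1_le_anti omega1_le_trans.
HB.instance Definition _ :=
  Order.POrder_isTotal.Build omega1_display omega1 omega1_le_total.

Definition oseg (a : omega1) : set omega1 := [set b | (b < a)%O].

Lemma omega1_min (A : set omega1) : A !=set0 ->
  exists2 a, A a & forall b, A b -> (a <= b)%O.
Proof.
move=> [a Aa]; have [|x [b Ab <-] minb] := @wo_rel_min (sval @` A).
  by exists (sval a), a.
by exists b => // c Ac; apply: minb; exists c.
Qed.

Lemma omega1_wf : well_founded (fun a b : omega1 => (a < b)%O).
Proof.
move=> a; apply: contrapT => na.
have [|m nm minm] := @omega1_min [set b | ~ Acc (fun a b => (a < b)%O) b].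
  by exists a.
apply: nm; constructor=> b bm; apply: contrapT => nb.
by have := minm b nb; rewrite leNgt bm.
Qed.

Lemma oseg_countable (a : omega1) : countable (oseg a).
Proof.
case: a => x xP; have /asboolP/countable_injP[f finj] := xP.
apply/countable_injP; exists (f \o sval) => b c /set_mem bx /set_mem cx fbc.
by apply/val_inj/finj => //; apply/mem_set; [exact: (ltW bx) | exact: (ltW cx)].
Qed.

Lemma omega1_uncountable : ~ countable [set: omega1].
Proof.
move=> cT.
have cantor : ~ countable [set: set nat].
  move=> /countable_injP[f finj].
  pose D := [set n | exists2 A, f A = n & ~ A n].
  have DfD : ~ D (f D).
    move=> DD; have [A fAD nA] := DD.
    have AD : A = D by apply: finj => //; exact: in_setT.
    by apply: nA; rewrite AD.
  by apply: (DfD); exists D.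
pose W := [set x | countable (wo_low x)].
have cW : countable W.
  have -> : W = sval @` [set: omega1].
    apply/seteqP; split=> [x xW|_ [[x xP] _ <-]]; last exact: (asboolW xP).
    by exists (exist _ x (asboolT xW)).
  exact: sub_countable (card_image_le _ _) cT.
have [|x nWx minx] := @wo_rel_min (~` W).
  apply: contrapT => nW; apply: cantor.
  suff -> : [set: set nat] = W by [].
  apply/seteqP; split=> // y _; apply: contrapT => nWy.
  by apply: nW; exists y.
apply: (nWx); rewrite /W /=.
have sub : wo_low x `<=` W `|` [set x].
  move=> y yx; case: (pselect (W y)) => [|nWy]; first by left.
  by right; apply: wo_rel_anti; rewrite [wo_rel y x]yx minx.
apply: (sub_countable (subset_card_le sub)).
rewrite -bigcup2E; apply: bigcup_countable => // -[|[|n]] _ //=.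
Qed.

(** [osucc a b]: b = a + 1. *)
Definition osucc (a b : omega1) : Prop :=
  (a < b)%O /\ forall c, (a < c)%O -> (b <= c)%O.

Definition is_zero (a : omega1) : Prop := forall b, ~ (b < a)%O.
Definition is_succ (a : omega1) : Prop := exists b, osucc b a.
Definition is_limit (a : omega1) : Prop := ~ is_zero a /\ ~ is_succ a.

Lemma osucc_exists (a : omega1) : exists b, osucc a b.
Proof.
have [|b ab minb] := @omega1_min [set b | (a < b)%O]; last by exists b.
apply: contrapT => na; apply: omega1_uncountable.
have sub : [set: omega1] `<=` oseg a `|` [set a].
  move=> b _; case: (ltgtP b a) => [ba|ab|->]; [by left| |by right].
  by exfalso; apply: na; exists b.
apply: (sub_countable (subset_card_le sub)).
rewrite -bigcup2E; apply: bigcup_countable => // -[|[|n]] _ //=.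
exact: oseg_countable.
Qed.

Section transfinite_iteration.
Variables (U : Type) (F : set U -> set U) (A : set U).

Definition titer_body (a : omega1) (rec : forall b, (b < a)%O -> set U) :
    set U :=
  match pselect (is_succ a) with
  | left h => let: exist b hb := cid h in F (rec b (proj1 hb))
  | right _ =>
      if pselect (is_zero a) then A
      else [set x | forall b (ba : (b < a)%O), rec b ba x]
  end.

Definition titer : omega1 -> set U :=
  Fix omega1_wf (fun=> set U) titer_body.

Let titerE a : titer a = titer_body (fun b (_ : (b < a)%O) => titer b).
Proof.
apply: (Fix_eq omega1_wf (fun=> set U)) => x f g fg; suff -> : f = g by [].
by apply: functional_extensionality_dep => y; apply: funext => yx; exact: fg.
Qed.

Lemma titer0 a : is_zero a -> titer a = A.
Proof.
move=> a0; rewrite titerE /titer_body; case: pselect => [h|_].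
  by case: h (h) => b [ba _]; case: (a0 b).
by case: pselect.
Qed.

Lemma titerS a b : osucc a b -> titer b = F (titer a).
Proof.
move=> ab; rewrite titerE /titer_body; case: pselect => [h|[]]; last by exists a.
case: cid => c cb; suff -> : c = a by [].
case: ab cb => ab ab' [cb cb'].
apply/le_anti/andP; split; rewrite leNgt; apply/negP.
  by move=> /ab'; rewrite leNgt cb.
by move=> /cb'; rewrite leNgt ab.
Qed.

Lemma titer_lim a : is_limit a -> titer a = \bigcap_(b in oseg a) titer b.
Proof.
by move=> [a0 aS]; rewrite titerE /titer_body; case: pselect => // _; case: pselect.
Qed.

End transfinite_iteration.

(** An ordinal at most omega_1 is represented by the set of its predecessors:
   [a < omega_1] by [oseg a], and omega_1 itself by [[set: omega1]].  Thus
   equality of ordinals is equality of sets and a supremum is a union. *)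
Definition ordinal_le_omega1 : Type := set omega1.

(** * Trees

   A tree on [E] is a set of nonempty sequences ordered by [prefix]. *)

Section trees.
Variable E : eqType.
Implicit Type T : set (seq E).

Definition tree_on T : Prop := T !=set0 /\ ~ T [::].

Definition derived_tree T : set (seq E) :=
  [set s | T s /\ exists t, [/\ T t, prefix s t & s <> t]].

(** The set of all [b] below every [a] with [T^a] empty, i.e. the least such
   [a] if there is one and omega_1 otherwise. *)
Definition tree_order T : ordinal_le_omega1 :=
  [set b | forall a, titer derived_tree T a = set0 -> (b < a)%O].

End trees.

Definition tree_iso (E F : eqType) (S : set (seq E)) (T : set (seq F)) : Prop :=
  exists f : seq E -> seq F, set_bij S T f /\
    forall s t, S s -> S t -> prefix (f s) (f t) = prefix s t.

(** The successor ordinals [fs a n] increase strictly to [a]. *)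
Definition fundamental (fs : omega1 -> nat -> omega1) : Prop :=
  forall a, is_limit a ->
    [/\ forall n, is_succ (fs a n),
        forall n, (fs a n < fs a n.+1)%O,
        forall n, (fs a n < a)%O &
        forall b, (b < a)%O -> exists n, (b < fs a n)%O].

Lemma fundamental_exists : exists fs, fundamental fs.
Proof.
suff /choice[fs fsP] : forall a, exists u : nat -> omega1, is_limit a ->
    [/\ forall n, is_succ (u n), forall n, (u n < u n.+1)%O,
        forall n, (u n < a)%O & forall b, (b < a)%O -> exists n, (b < u n)%O].
  by exists fs.
move=> a; case: (pselect (is_limit a)) => [la|nla]; last by exists (fun=> a).
have /choice[S SP] := osucc_exists.
have Sa b : (b < a)%O -> (S b < a)%O.
  move=> ba; rewrite lt_neqAle; have [_ Sb] := SP b; rewrite Sb // andbT.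
  by apply/negP => /eqP bE; case: la => _; apply; exists b; rewrite -bE; exact: SP.
have [z za] : exists b, (b < a)%O.
  by apply: contrapT => n; case: la => + _; apply=> b ba; apply: n; exists b.
have /countable_injP[f finj] := oseg_countable a.
have /choice[g gP] : forall n, exists b,
    (b < a)%O /\ forall c, (c < a)%O -> f c = n -> c = b.
  move=> n; case: (pselect (exists2 c, (c < a)%O & f c = n)) => [[c ca fc]|nc].
    exists c; split=> // d da fd; apply: finj; rewrite ?inE //.
    by rewrite fd fc.
  by exists z; split=> // c ca fc; exfalso; apply: nc; exists c.
pose u := fix u n := if n is m.+1 then S (Order.max (u m) (g m)) else S z.
exists u => _; have ua n : (u n < a)%O.
  by elim: n => [|n IH] /=; apply: Sa => //; rewrite gt_max IH (gP n).1.
split=> //.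
- by case=> [|n] /=; eexists; exact: SP.
- move=> n /=; have [+ _] := SP (Order.max (u n) (g n)).
  by apply: le_lt_trans; rewrite le_max lexx.
move=> b ba; exists (f b).+1 => /=; have [+ _] := SP (Order.max (u (f b)) (g (f b))).
by apply: le_lt_trans; rewrite le_max -((gP (f b)).2 b ba erefl) lexx orbT.
Qed.

(** [Ts fs a] is T(a,s), realized as a tree on [nat].  As [Ts fs 0] is empty,
   the first two rules give T(1,s).  At a limit the [n]-th copy has its first
   entries [k] replaced by [pickle (n, k)], which makes the copies disjoint and
   mutually incomparable. *)
Inductive Ts (fs : omega1 -> nat -> omega1) : omega1 -> seq nat -> Prop :=
| Ts_init a b n of osucc a b : Ts fs b [:: n]
| Ts_succ a b n s of osucc a b & Ts fs a s : Ts fs b (n :: s)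
| Ts_limit a n k s of is_limit a & Ts fs (fs a n) (k :: s) :
    Ts fs a (pickle (n, k) :: s).

(** * Indices of a Banach space *)

Section indices.
Variables (R : realType) (X : completeNormedModType R).
Implicit Types (T : set (seq X)) (s : seq X) (y : nat -> X).

Definition separable : Prop := exists D : set X, countable D /\ dense D.

Definition ell1 : set R^nat := [set a : R^nat | cvgn [normed series a]].
Definition ell1_norm (a : R^nat) : R := limn [normed series a].

(** An isomorphic embedding of ell_1 into [X]; its values off [ell1] are
   irrelevant. *)
Definition contains_ell1 : Prop :=
  exists J : R^nat -> X,
    (forall r a b, ell1 a -> ell1 b ->
       J (fun k => r * a k + b k) = r *: J a + J b) /\
    exists c C : R, [/\ 0 < c, 0 < C &
      forall a, ell1 a -> c * ell1_norm a <= `|J a| <= C * ell1_norm a].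

Definition weakly_null y : Prop :=
  forall f : {linear X -> R^o}, continuous f ->
    (fun n => f (y n)) @ \oo --> (0 : R^o).

(** [p = [::]] gives the initial nodes of [T], and [T p] the immediate
   successors of the node [p]. *)
Definition s_subsequence T y : Prop :=
  exists2 p, p = [::] \/ T p & set_bij [set: nat] [set v | T (rcons p v)] y.

Definition weakly_null_tree (fs : omega1 -> nat -> omega1) T : Prop :=
  [/\ tree_on T,
      exists2 a, ~ is_zero a & tree_iso T (Ts fs a),
      forall p v, p <> [::] -> T (rcons p v) -> T p &
      forall y, s_subsequence T y -> weakly_null y].

Definition lincomb (a : nat -> R) s (n : nat) : X :=
  \sum_(0 <= i < n) a i *: s`_i.

(** A finite sequence is basic if it is linearly independent; its basis
   constant is the maximum of the norms of its initial projections. *)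
Definition basic_le (K : R) s : Prop :=
  (forall a, lincomb a s (size s) = 0 -> forall i, (i < size s)%N -> a i = 0) /\
  forall a n, (n <= size s)%N -> `|lincomb a s n| <= K * `|lincomb a s (size s)|.

Definition ell1p_sequence (K : R) s : Prop :=
  [/\ forall v, v \in s -> `|v| = 1,
      basic_le K s &
      forall a : nat -> R, (forall i, 0 <= a i) ->
        K^-1 * \sum_(0 <= i < size s) a i <= `|lincomb a s (size s)|].

Definition ell1p_weakly_null_tree fs (K : R) T : Prop :=
  weakly_null_tree fs T /\ forall s, T s -> ell1p_sequence K s.

Definition ell1p_weakly_null_index fs : ordinal_le_omega1 :=
  \bigcup_(K in [set K : R | 1 <= K])
    \bigcup_(T in ell1p_weakly_null_tree fs K) tree_order T.

Definition dual_norm (f : X -> R) : R :=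
  sup [set `|f x| | x in [set x : X | `|x| <= 1]].

Definition dual_ball : set {linear X -> R^o} :=
  [set f | continuous f /\ dual_norm f <= 1].

Definition weak_star_cvg (f_ : nat -> {linear X -> R^o})
    (f : {linear X -> R^o}) : Prop :=
  forall x, (fun m => f_ m x) @ \oo --> f x.

Definition szlenk_step (eps : R) (P : set {linear X -> R^o}) :
    set {linear X -> R^o} :=
  [set f | dual_ball f /\
    exists f_ : nat -> {linear X -> R^o},
      [/\ forall m, P (f_ m), weak_star_cvg f_ f &
          (eps%:E <= limn_einf (fun m => (dual_norm (f_ m \- f))%:E))%E]].

Definition szlenk_set (eps : R) : omega1 -> set {linear X -> R^o} :=
  titer (szlenk_step eps) dual_ball.

Definition szlenk_index_eps (eps : R) : ordinal_le_omega1 :=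
  \bigcup_(a in [set a | szlenk_set eps a !=set0]) oseg a.

Definition szlenk_index : ordinal_le_omega1 :=
  \bigcup_(eps in [set eps : R | 0 < eps]) szlenk_index_eps eps.

End indices.

(* Main.v *)
Require Import Defs.
From HB Require Import structures.
From mathcomp Require Import all_boot all_order all_algebra.
From mathcomp Require Import all_classical all_reals all_analysis.
From mathcomp Require Import lra.

Set Implicit Arguments.
Unset Strict Implicit.
Unset Printing Implicit Defensive.

Import Order.TTheory GRing.Theory Num.Theory.
Import numFieldNormedType.Exports.

Local Open Scope classical_set_scope.
Local Open Scope card_scope.
Local Open Scope ring_scope.

(** The Szlenk sets and the trees are matched ordinal by ordinal.

    From trees to functionals: every node of an l_1^+-K-tree T is bounded below
    by 1/K under some functional of the dual ball (Hahn-Banach).  Going up a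
    tree isomorphic to T(a,s), take a weak* cluster point f of the functionals
    f_n found above the immediate successors y_n of a node.  As f(y_n) -> 0 but
    f_n(y_n) >= 1/K, the f_n oscillate near f by at least 1/(2K), so f survives
    one more derivation.  Since limits of Szlenk sets need not be weak* closed,
    this is run with a closed derivation ([wder]) whose iterates lie in the
    Szlenk sets of half the parameter.

    From functionals to trees: if f_n -> f weak* and ||f_n - f|| > e, choose u_n
    in the unit ball with (f_n - f)(u_n) > e.  By Rosenthal's theorem some
    subsequence of (u_n) is weakly Cauchy, and normalized differences of it form
    a weakly null sequence (x_k) with f_{m_k}(x_k) bounded below.  Continuing
    with f_{m_k} above the node x_k keeps one functional large on each branch,
    and Mazur's argument keeps the basis constants below 2. *)

(** * Countable ordinals and the trees T(a,s) *)

Lemma zero_succ_limit (a : omega1) : [\/ is_zero a, is_succ a | is_limit a].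
Proof.
case: (pselect (is_zero a)) => a0; first exact: Or31.
by case: (pselect (is_succ a)) => aS; [exact: Or32 | exact: Or33].
Qed.

Lemma osucc_le (a b c : omega1) : osucc a b -> (c < b)%O -> (c <= a)%O.
Proof. by move=> [_ ab] cb; rewrite leNgt; apply/negP => /ab; rewrite leNgt cb. Qed.

Lemma osucc_inj (a b c : omega1) : osucc a c -> osucc b c -> a = b.
Proof.
move=> ac bc; apply/le_anti.
by rewrite (osucc_le bc ac.1) (osucc_le ac bc.1).
Qed.

Lemma limit_succ_lt (a b c : omega1) :
  is_limit a -> osucc b c -> (b < a)%O -> (c < a)%O.
Proof.
move=> [_ aS] bc ba; rewrite lt_neqAle (bc.2 _ ba) andbT.
by apply/eqP => ca; apply: aS; exists b; rewrite -ca.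
Qed.

Section titer_lemmas.
Variables (U : Type) (F : set U -> set U) (A : set U).
Hypothesis Fmono : forall P Q, P `<=` Q -> F P `<=` F Q.
Hypothesis FA : F A `<=` A.

(** The assumption [FA] concerns [A] alone, so at [a = g + 1] the inclusion of [F] of the [g]-th
    iterate in that iterate needs a case split on [g]. For [g] a limit and [c < g], the successor of
    [c] is still below [g], and its iterate is [F] of the [c]-th one. *)
Lemma titer_decreasing a b :
  (b <= a)%O -> titer F A a `<=` titer F A b.
Proof.
elim/(well_founded_ind omega1_wf) : a b => a IH b.
rewrite le_eqVlt => /orP[/eqP->//|ba].
case: (zero_succ_limit a) => [a0|[g ga]|la]; first by case: (a0 _ ba).
  apply: (@subset_trans _ (titer F A g)); last first.
    by apply: IH; [exact: ga.1 | exact: osucc_le ba].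
  rewrite (titerS F A ga).
  case: (zero_succ_limit g) => [g0|[h hg]|lg].
  - by rewrite titer0.
  - rewrite {2}(titerS F A hg); apply: Fmono; apply: IH; first exact: ga.1.
    exact: ltW hg.1.
  - rewrite {2}titer_lim// => x Fx c /= cg.
    have [d cd] := osucc_exists c.
    have dg := limit_succ_lt lg cd cg.
    apply: (IH d (lt_trans dg ga.1) c (ltW cd.1)).
    rewrite (titerS F A cd); apply: Fmono Fx.
    by apply: IH (ltW cg); exact: ga.1.
by rewrite titer_lim// => x; apply.
Qed.

Lemma titer_sub a : titer F A a `<=` A.
Proof.
have [z _ zmin] := omega1_min (ex_intro setT a I).
have z0 : is_zero z by move=> d dz; have := zmin d I; rewrite leNgt dz.
by rewrite -[X in _ `<=` X](titer0 F A z0); exact: titer_decreasing (zmin a I).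
Qed.

End titer_lemmas.

Lemma derived_tree_mono (E : eqType) (S T : set (seq E)) :
  S `<=` T -> derived_tree S `<=` derived_tree T.
Proof.
move=> ST s [Ss [t [St st nst]]]; split; first exact: ST.
by exists t; split => //; exact: ST.
Qed.

Lemma derived_tree_sub (E : eqType) (T : set (seq E)) : derived_tree T `<=` T.
Proof. by move=> s []. Qed.

Lemma derived_decreasing (E : eqType) (T : set (seq E)) a b :
  (b <= a)%O -> titer (@derived_tree _) T a `<=` titer (@derived_tree _) T b.
Proof.
by apply: titer_decreasing; [exact: derived_tree_mono | exact: derived_tree_sub].
Qed.

Lemma derived_sub (E : eqType) (T : set (seq E)) a :
  titer (@derived_tree _) T a `<=` T.
Proof.
by apply: titer_sub; [exact: derived_tree_mono | exact: derived_tree_sub].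
Qed.

(** Survival under derivation travels along a partial map: [U] is the part of [S] where [h] behaves
    well, and it is closed upwards so that the extension witnessing the survival of a node of [U]
    stays in [U]. *)
Lemma derived_tree_map (E F : eqType) (S : set (seq E)) (T : set (seq F))
    (U : set (seq E)) (h : seq E -> seq F) :
  (forall s t, U s -> S t -> prefix s t -> U t) ->
  (forall s, S s -> U s -> T (h s)) ->
  (forall s t, S s -> S t -> U s -> U t -> prefix s t -> s <> t ->
     prefix (h s) (h t) /\ h s <> h t) ->
  forall b s, titer (@derived_tree _) S b s -> U s -> titer (@derived_tree _) T b (h s).
Proof.
move=> Uup hST hprefix; elim/(well_founded_ind omega1_wf) => b IH s.
have SbS c := @derived_sub _ S c.
case: (zero_succ_limit b) => [b0|[c cb]|lb].
- by rewrite !titer0//; exact: hST.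
- rewrite !(titerS _ _ cb) => -[Ss [t [St st nst]]] Us.
  have Ut : U t by apply: Uup st => //; exact: SbS St.
  split; first exact: IH cb.1 _ Ss Us.
  have [pst nhst] := hprefix _ _ (SbS _ _ Ss) (SbS _ _ St) Us Ut st nst.
  by exists (h t); split => //; exact: IH cb.1 _ St Ut.
- rewrite !titer_lim// => Ss Us c cb; apply: IH => //.
  exact: Ss.
Qed.

Lemma tree_iso_sym (E F : eqType) (S : set (seq E)) (T : set (seq F)) :
  tree_iso S T -> tree_iso T S.
Proof.
move=> [h [[hfun hinj hsurj] hpre]].
have /choice[g gP] : forall t, exists s, T t -> S s /\ h s = t.
  move=> t; case: (pselect (T t)) => [Tt|nTt]; last by exists [::].
  by have [s Ss st] := hsurj t Tt; exists s.
exists g; split; last first.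
  move=> s t /gP[Sg hs] /gP[Sg' ht].
  by rewrite -hpre// hs ht.
split=> [t /gP[]//|s t /set_mem /gP[_ hs] /set_mem /gP[_ ht] st|s Ss].
  by rewrite -hs -ht st.
exists (h s); first exact: hfun.
have [Sg hg] := gP (h s) (hfun _ Ss).
by apply: hinj; rewrite ?inE.
Qed.

Lemma tree_iso_derived_eq0 (E F : eqType) (S : set (seq E)) (T : set (seq F)) b :
  tree_iso S T -> titer (@derived_tree _) T b = set0 -> titer (@derived_tree _) S b = set0.
Proof.
move=> [h [[hfun hinj _] hpre]] T0; apply/seteqP; split => // s Ss.
have : titer (@derived_tree _) T b (h s); last by rewrite T0.
apply: (@derived_tree_map _ _ S T setT) Ss _ => //; first by move=> t St _; exact: hfun.
move=> s1 s2 Ss1 Ss2 _ _ pre ne; split; first by rewrite hpre.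
by move=> /hinj hs; apply: ne; apply: hs; rewrite inE.
Qed.

(** * The order of T(a,s) *)

Section Ts_trees.
Variable fs : omega1 -> nat -> omega1.
Hypothesis hfs : fundamental fs.

Lemma fundamental_lt a n : is_limit a -> (fs a n < a)%O.
Proof. by move=> /hfs[]. Qed.

Lemma fundamental_mono a m n : is_limit a -> (m <= n)%N -> (fs a m <= fs a n)%O.
Proof.
move=> /hfs[_ fsS _ _]; elim: n => [|n IH]; first by rewrite leqn0 => /eqP->.
rewrite leq_eqVlt => /orP[/eqP->//|mn].
exact: le_trans (IH mn) (ltW (fsS n)).
Qed.

Lemma Ts_nil a : ~ Ts fs a [::].
Proof. by move=> h; inversion h. Qed.

Lemma Ts_zero a s : is_zero a -> ~ Ts fs a s.
Proof.
move=> + h; case: h => [b c n bc|b c n t bc _|b n k t lb _] a0.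
- exact: a0 bc.1.
- exact: a0 bc.1.
- by case: lb.
Qed.

Lemma Ts_succE a b n s : osucc a b -> Ts fs b (n :: s) <-> s = [::] \/ Ts fs a s.
Proof.
move=> ab; split=> [h|[->|h]]; last 2 first.
- exact: Ts_init ab.
- exact: Ts_succ ab h.
move eu : (n :: s) h => u h; case: h ab eu => [c d m cd|c d m t cd h|c m k t lc _] ab.
- by move=> [_ ->]; left.
- by move=> [_ ->]; right; rewrite (osucc_inj ab cd).
- by case: lc => _ []; exists a.
Qed.

Lemma Ts_limitE a s : is_limit a -> Ts fs a s <->
  exists (n k : nat) t, s = pickle (n, k) :: t /\ Ts fs (fs a n) (k :: t).
Proof.
move=> la; split=> [h|[n [k [t [-> h]]]]]; last exact: Ts_limit.
case: h la => [c d m cd|c d m t cd _|c m k t _ h] [_ la].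
- by case: la; exists c.
- by case: la; exists c.
- by exists m, k, t.
Qed.

Lemma Ts_limit_cons a (n k : nat) t : is_limit a ->
  Ts fs a (pickle (n, k) :: t) <-> Ts fs (fs a n) (k :: t).
Proof.
move=> la; rewrite Ts_limitE//; split=> [[n' [k' [t' [+ h]]]]|h]; last by exists n, k, t.
by move=> [/(pcan_inj pickleK)[-> ->] ->].
Qed.

Lemma Ts_prefix a s i : Ts fs a s -> (0 < i)%N -> Ts fs a (take i s).
Proof.
move=> h; elim: h i => {a s} [a b n ab|a b n s ab _ IH|a n k s la _ IH] [//|i] _ /=.
- exact: Ts_init ab.
- case: i => [|i]; first by rewrite take0; exact: Ts_init ab.
  by apply: Ts_succ ab _; exact: IH.
- apply: Ts_limit => //; exact: (IH i.+1).
Qed.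

Lemma Ts_nonempty a : ~ is_zero a -> exists s, Ts fs a s.
Proof.
elim/(well_founded_ind omega1_wf) : a => a IH a0.
case: (zero_succ_limit a) => [//|[b ba]|la].
  by exists [:: 0%N]; exact: Ts_init ba.
have [fsS _ fsa _] := hfs la.
have [b bfs] := fsS 0%N.
exists [:: pickle (0%N, 0%N)]; apply: Ts_limit => //.
exact: Ts_init bfs.
Qed.

(** At a successor, a survivor has a proper extension of length at least 2, and deleting first
    entries carries that extension into an empty derivative of the preceding tree. At a limit, a
    survivor lies in one copy, which is exhausted at an earlier stage. *)
Lemma Ts_derived_top a : titer (@derived_tree _) (Ts fs a) a = set0.
Proof.
elim/(well_founded_ind omega1_wf) : a => a IH; apply/seteqP; split => // s.
case: (zero_succ_limit a) => [a0|[b ba]|la].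
- by rewrite titer0// => /Ts_zero; exact.
- rewrite (titerS _ _ ba) => -[/derived_sub Ts_s [t [Tt st nst]]].
  have Ut : (1 < size t)%N.
    rewrite ltnNge; apply/negP => t1; apply: nst.
    move: st => /prefixP[[|x u] tE]; first by rewrite tE cats0.
    case: s Ts_s tE => [/Ts_nil//|y s] _ tE.
    by move: t1; rewrite tE /= size_cat /= addnS.
  have /= := @derived_tree_map _ _ (Ts fs a) (Ts fs b) [set u | (1 < size u)%N]
    behead _ _ _ b t Tt Ut.
  rewrite IH; last exact: ba.1.
  apply.
  + move=> u v /= + _ /prefixP[w ->]; rewrite size_cat => /leq_trans; apply.
    exact: leq_addr.
  + by move=> [//|n [//|m u]] /(Ts_succE _ _ ba)[].
  + move=> [//|n u] [//|m v] /= _ _ _ _ /andP[/eqP-> uv] ne; split => //.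
    by move=> uvE; apply: ne; rewrite uvE.
- move=> Ts_s; have /(Ts_limitE _ la)[n [k [t [sE _]]]] := derived_sub Ts_s.
  (* [U] is the [n]-th copy inside T(a,s), and [h] decodes it. *)
  pose U := [set s' : seq nat | exists (k' : nat) t', s' = pickle (n, k') :: t'].
  pose h (s' : seq nat) := if s' is m :: t' then
    if (unpickle m : option (nat * nat)) is Some (_, k') then k' :: t' else [::] else [::].
  have hE (n' k' : nat) t' : h (pickle (n', k') :: t') = k' :: t'.
    by rewrite /h pickleK.
  have fsa := fundamental_lt n la.
  have /= := @derived_tree_map _ _ (Ts fs a) (Ts fs (fs a n)) U h _ _ _ a s Ts_s _.
  move=> hs; suff : titer (@derived_tree _) (Ts fs (fs a n)) a (h s).
    by move=> /(derived_decreasing (ltW fsa)); rewrite IH.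
  apply: hs.
  + move=> u v [k' [t' ->]] _ /prefixP[w ->].
    by exists k', (t' ++ w).
  + by move=> u + [k' [t' uE]]; rewrite uE hE Ts_limit_cons.
  + move=> u v _ _ [k1 [t1 ->]] [k2 [t2 ->]]; rewrite !hE/=.
    move=> /andP[/eqP/(pcan_inj pickleK)[->]] -> ne; rewrite eqxx; split => //.
    by move=> -[t12]; apply: ne; rewrite t12.
  + by exists k, t.
Qed.

(** For [c = a + 1] the node [[:: 0]] survives [a] derivations: the map [cons 0] copies T(a,s) above
    it, and the derivatives of T(a,s) before stage [a] are nonempty. For a limit [c], a copy of
    index beyond [b] suffices. *)
Lemma Ts_derived_neq0 c b : (b < c)%O ->
  titer (@derived_tree _) (Ts fs c) b !=set0.
Proof.
elim/(well_founded_ind omega1_wf) : c b => c IH b bc.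
case: (zero_succ_limit c) => [c0|[a ac]|lc]; first by case: (c0 _ bc).
- suff H : forall d, (d <= a)%O -> titer (@derived_tree _) (Ts fs c) d [:: 0%N].
    by exists [:: 0%N]; apply: H; exact: osucc_le bc.
  elim/(well_founded_ind omega1_wf) => d IHd da.
  case: (zero_succ_limit d) => [d0|[e ed]|ld].
  + by rewrite titer0//; exact: Ts_init ac.
  + rewrite (titerS _ _ ed); split.
      by apply: IHd; [exact: ed.1 | exact: le_trans (ltW ed.1) da].
    have ea := lt_le_trans ed.1 da.
    have [s Ts_s] := IH _ ac.1 _ ea.
    have s0 : s <> [::] by move=> s0; move: (derived_sub Ts_s); rewrite s0; exact: Ts_nil.
    exists (0%N :: s); split; [|by rewrite /= prefix0s|by case: (s) s0].
    apply: (@derived_tree_map _ _ (Ts fs a) (Ts fs c) setT (cons 0%N)) Ts_s _ => //.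
      by move=> s' /= Ts_s' _; exact: Ts_succ ac Ts_s'.
    by move=> s' t _ _ _ _ st ne; split => // -[].
  + by rewrite titer_lim// => e /= ed; apply: IHd => //; exact: le_trans (ltW ed) da.
- have [_ _ fsc fsb] := hfs lc.
  have [n bn] := fsb _ bc.
  have [s Ts_s] := IH _ (fsc n) _ bn.
  pose h (s' : seq nat) := if s' is m :: t' then pickle (n, m) :: t' else [::].
  exists (h s).
  apply: (@derived_tree_map _ _ (Ts fs (fs c n)) (Ts fs c) setT h) Ts_s _ => //.
    by move=> [/Ts_nil//|k s'] /= Ts_s' _; exact: Ts_limit.
  move=> [|k1 s1] t2; first by move=> /Ts_nil.
  case: t2 => [|k2 s2]; first by move=> _ /Ts_nil.
  move=> /= _ _ _ _ /andP[/eqP-> ->] ne; rewrite eqxx; split => //.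
  by move=> -[s12]; apply: ne; rewrite s12.
Qed.

Lemma tree_order_iso (E : eqType) (T : set (seq E)) a :
  tree_iso T (Ts fs a) -> tree_order T = oseg a.
Proof.
move=> iso; apply/seteqP; split=> b /=.
  by apply; exact: tree_iso_derived_eq0 iso (Ts_derived_top a).
move=> ba c Tc0; rewrite ltNge; apply/negP => cb.
have := tree_iso_derived_eq0 (tree_iso_sym iso) Tc0.
have [s /(derived_decreasing cb) Ts_s] := Ts_derived_neq0 ba.
by move=> T0; move: Ts_s; rewrite T0.
Qed.

End Ts_trees.

(** * Hahn-Banach *)

Definition sublinear (R : realType) (V : lmodType R) (p : V -> R) : Prop :=
  (forall x y, p (x + y) <= p x + p y) /\
  (forall t x, 0 <= t -> p (t *: x) = t * p x).

Section hahn_banach.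
Variables (R : realType) (V : lmodType R).
Implicit Types (p q : V -> R) (C : set (V * R)).

Lemma sublinear0 p : sublinear p -> p 0 = 0.
Proof. by move=> [_ /(_ 0 0 (lexx _))]; rewrite scale0r mul0r. Qed.

Lemma sublinear_ge p q x : sublinear p -> (forall y, p y <= q y) ->
  - q (- x) <= p x.
Proof.
move=> sp pq; rewrite lerNl; apply: le_trans (pq _).
by rewrite -subr_ge0 opprK -(sublinear0 sp) -(addNr x); apply: sp.1.
Qed.

(** The reverse inequality is the hypothesis for [t^-1] and [t *: x]. *)
Lemma pos_homogeneous p : (forall t x, 0 < t -> p (t *: x) <= t * p x) ->
  p 0 = 0 -> forall t x, 0 <= t -> p (t *: x) = t * p x.
Proof.
move=> ple p0 t x; rewrite le_eqVlt => /orP[/eqP<-|t0].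
  by rewrite scale0r mul0r.
apply/le_anti; rewrite ple//= -ler_pdivlMl//.
have {1}-> : x = t^-1 *: (t *: x) by rewrite scalerA mulVf ?scale1r// gt_eqF.
by apply: ple; rewrite invr_gt0.
Qed.

(** A pair [(v, s)] encodes the constraint that a functional be at least [s] at [v]. *)
Definition convex_cone C : Prop :=
  [/\ C (0, 0), (forall u v, C u -> C v -> C (u + v)) &
      (forall t v s, 0 < t -> C (v, s) -> C (t *: v, t * s))].

(** Take for [p x] the infimum of [q (x + v) - s] over the cone; the bound [s <= q v] keeps it
    finite. A linear functional below [p] then satisfies all the constraints in [C]. *)
Lemma sublinear_below_cone q C : sublinear q -> convex_cone C ->
  (forall v s, C (v, s) -> s <= q v) ->
  exists p, [/\ sublinear p, forall x, p x <= q x &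
                forall v s, C (v, s) -> p (- v) <= - s].
Proof.
move=> sq [C0 CD CZ] Cq.
pose S x := [set r | exists v s, C (v, s) /\ r = q (x + v) - s].
have lbS x r : S x r -> - q (- x) <= r.
  move=> [v [s [Cvs ->]]]; rewrite lerBrDr -lerBrDl.
  apply: le_trans (Cq _ _ Cvs) _; rewrite opprK.
  by have := sq.1 (x + v) (- x); rewrite addrAC subrr add0r.
have hS x : has_inf (S x).
  split; first by exists (q (x + 0) - 0), 0, 0.
  by exists (- q (- x)) => r /lbS.
pose p x := inf (S x).
have p_le x v s : C (v, s) -> p x <= q (x + v) - s.
  by move=> Cvs; apply: ge_inf; [case: (hS x) | exists v, s].
have le_p x r : (forall v s, C (v, s) -> r <= q (x + v) - s) -> r <= p x.
  move=> h; apply: lb_le_inf; first by case: (hS x).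
  by move=> _ [v [s [Cvs ->]]]; exact: h.
have pq x : p x <= q x by have := p_le x 0 0 C0; rewrite addr0 subr0.
exists p; split => //; last first.
  by move=> v s Cvs; have := p_le (- v) v s Cvs; rewrite addNr sublinear0// sub0r.
split.
  move=> x y; rewrite -lerBlDr; apply/le_p => v s Cvs.
  rewrite lerBlDr -lerBlDl; apply/le_p => w r Cwr.
  rewrite lerBlDr; have /= := p_le (x + y) (v + w) (s + r) (CD (v, s) (w, r) Cvs Cwr).
  rewrite addrACA; move/le_trans; apply.
  have := sq.1 (x + v) (y + w); lra.
apply: pos_homogeneous => [t x t0|].
  rewrite -ler_pdivrMl//; apply: (@le_p x) => v s Cvs.
  rewrite ler_pdivrMl//; apply: le_trans (p_le _ _ _ (CZ _ _ _ t0 Cvs)) _.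
  by rewrite -scalerDr (sq.2 _ _ (ltW t0)) mulrBr.
apply/le_anti/andP; split; first by apply: le_trans (pq 0) _; rewrite sublinear0.
by apply/le_p => v s /Cq; rewrite add0r subr_ge0.
Qed.

(** The pointwise infimum works; it is finite because every member is at least [- p (- x)] at
    [x]. *)
Lemma chain_sublinear p (A : set (V -> R)) : A !=set0 ->
  (forall q, A q -> sublinear q /\ forall x, q x <= p x) ->
  total_on A (fun q r => forall x, r x <= q x) ->
  exists r, [/\ sublinear r, forall x, r x <= p x &
                forall q, A q -> forall x, r x <= q x].
Proof.
move=> [q0 Aq0] Ap Atot.
have sp x q : A q -> - p (- x) <= q x.
  by move=> /Ap[sq qp]; apply: sublinear_ge.
pose S x := [set q x | q in A].
have hS x : has_inf (S x).
  split; first by exists (q0 x), q0.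
  by exists (- p (- x)) => _ [q Aq <-]; exact: sp.
pose r x := inf (S x).
have r_le x q : A q -> r x <= q x.
  by move=> Aq; apply: ge_inf; [case: (hS x) | exists q].
have le_r x c : (forall q, A q -> c <= q x) -> c <= r x.
  move=> h; apply: lb_le_inf; first by case: (hS x).
  by move=> _ [q Aq <-]; exact: h.
exists r; split; last by move=> q Aq x; exact: r_le.
  split.
    move=> x y; rewrite -lerBlDr; apply/le_r => q1 A1.
    rewrite lerBlDr -lerBlDl; apply/le_r => q2 A2.
    (* Subadditivity of the infimum needs a single member below both [q1] and [q2]: the smaller one
       in the chain. *)
    have [q [Aq q1x q2y]] : exists q, [/\ A q, q x <= q1 x & q y <= q2 y].
      by case: (Atot _ _ A1 A2) => h; [exists q2 | exists q1].
    have := (Ap _ Aq).1.1 x y; have := r_le (x + y) q Aq; lra.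
  apply: pos_homogeneous => [t x t0|].
    rewrite -ler_pdivrMl//; apply/le_r => q Aq.
    by rewrite ler_pdivrMl// -(Ap _ Aq).1.2 ?r_le// ltW.
  apply/le_anti/andP; split; first by rewrite -(sublinear0 (Ap _ Aq0).1) r_le.
  by apply/le_r => q /Ap[/sublinear0->].
by move=> x; exact: le_trans (r_le x _ Aq0) ((Ap _ Aq0).2 x).
Qed.

(* A minimal sublinear functional is odd, hence linear. *)
Theorem hahn_banach p : sublinear p ->
  exists f : {linear V -> R^o}, forall x, f x <= p x.
Proof.
move=> sp; pose P q := sublinear q /\ forall x, q x <= p x.
pose T := {q : V -> R | P q}.
(* The order is reversed, so that a maximal element is a minimal functional. *)
pose le_T (q r : T) := `[< forall x, sval r x <= sval q x >].
have [||||[q [sq qp]] qmin] := @Zorn T le_T.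
- by move=> q; apply/asboolP.
- move=> q r s /asboolP qr /asboolP rs; apply/asboolP => x.
  exact: le_trans (rs x) (qr x).
- move=> [q Pq] [r Pr] /asboolP/= qr /asboolP/= rq; apply: eq_exist.
  by apply: funext => x; apply/le_anti; rewrite qr rq.
- move=> A Atot; case: (pselect (A !=set0)) => [[q0 Aq0]|nA]; last first.
    by exists (exist _ p (conj sp (fun x => lexx _))) => q Aq; case: nA; exists q.
  have [|||r [sr rp rA]] := @chain_sublinear p (sval @` A).
  + by exists (sval q0), q0.
  + by move=> _ [[q Pq] _ <-].
  + move=> _ _ [q Aq <-] [r Ar <-].
    by case: (Atot q r Aq Ar) => /asboolP h; [left|right].
  by exists (exist _ r (conj sr rp)) => q Aq; apply/asboolP; apply: rA; exists q.
have qodd y : q (- y) = - q y.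
  apply/le_anti/andP; split; last first.
    by have := sublinear_ge (- y) sq (fun=> lexx _); rewrite opprK.
  (* Lowering [q] along the ray through [(y, q y)] gives a sublinear [s] below [q] with
     [s (- y) <= - q y]; minimality forces [s = q]. *)
  pose C := [set vs | exists2 t, 0 <= t & vs = (t *: y, t * q y)].
  have [||s [ss sle sC]] := @sublinear_below_cone q C sq.
  - split.
    + by exists 0; rewrite ?scale0r ?mul0r.
    + move=> _ _ [t t0 ->] [u u0 ->]; exists (t + u); first exact: addr_ge0.
      by rewrite scalerDl mulrDl.
    + move=> t _ _ t0 [u u0 [-> ->]]; exists (t * u); first by rewrite mulr_ge0// ltW.
      by rewrite scalerA mulrA.
  - by move=> _ _ [t t0 [-> ->]]; rewrite sq.2.
  have Ps : P s by split => // x; exact: le_trans (sle x) (qp x).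
  have sE : s = q.
    have /(congr1 sval) // : exist P s Ps = exist _ q (conj sq qp).
    by apply: qmin; apply/asboolP.
  rewrite -{1}sE.
  by apply: sC; exists 1; rewrite ?scale1r ?mul1r.
have qD x y : q (x + y) = q x + q y.
  apply/le_anti; rewrite sq.1/= -lerBrDr -qodd.
  by have := sq.1 (x + y) (- y); rewrite addrK.
have qlin : linear_for *:%R (q : V -> R^o).
  move=> t x y; rewrite qD; congr (_ + _).
  case: (leP 0 t) => t0; first exact: sq.2.
  rewrite -[t]opprK scaleNr qodd sq.2 ?oppr_ge0 ?ltW//.
  by rewrite [RHS]scaleNr.
pose m := GRing.isLinear.Build R V R^o *:%R q qlin.
pose f : {linear V -> R^o} := HB.pack q m.
by exists f => x; exact: qp.
Qed.

End hahn_banach.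

(** * Functionals in the dual ball *)

Section dual.
Variables (R : realType) (X : completeNormedModType R).
Implicit Types (f g : {linear X -> R^o}) (x y : X).

Lemma linear_bound_continuous f : (forall x, `|f x| <= `|x|) -> continuous f.
Proof.
move=> fb; apply: bounded_linear_continuous; apply/linear_boundedP.
near=> r => x; apply: le_trans (fb x) _.
rewrite -[leLHS]mul1r ler_wpM2r//.
Unshelve. all: by end_near. Qed.

(** The bound [M] makes the supremum in [dual_norm] a genuine one. *)
Lemma dual_norm_ge (h : X -> R) M x : (forall y, `|y| <= 1 -> `|h y| <= M) ->
  `|x| <= 1 -> `|h x| <= dual_norm h.
Proof.
move=> hM x1; apply: ub_le_sup; last by exists x.
by exists M => _ [y /= /hM + <-].
Qed.

Lemma dual_norm_le (h : X -> R) M : (forall y, `|y| <= 1 -> `|h y| <= M) ->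
  dual_norm h <= M.
Proof.
move=> hM; apply: ge_sup; first by exists `|h 0|, 0 => //=; rewrite normr0.
by move=> _ [y /= /hM + <-].
Qed.

Lemma dual_ballP f : dual_ball f <-> forall x, `|f x| <= `|x|.
Proof.
split=> [[fc f1] x|fb]; last first.
  split; first exact: linear_bound_continuous.
  by apply: dual_norm_le => y; apply: le_trans.
have [->|x0] := eqVneq x 0; first by rewrite linear0 !normr0.
have /linear_boundedP/pinfty_ex_gt0[r r0 rf] : bounded_near f (nbhs 0).
  exact/linear_bounded_continuous.
have nx : 0 < `|x| by rewrite normr_gt0.
have : `|f (`|x|^-1 *: x)| <= 1.
  apply: le_trans f1; apply: (@dual_norm_ge _ r); last first.
    by rewrite normrZ normfV normr_id mulVf// gt_eqF.
  by move=> y y1; apply: le_trans (rf y) _; rewrite ler_piMr// ltW.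
by rewrite linearZ normrZ normfV normr_id mulrC ler_pdivrMr// mul1r.
Qed.

Lemma dual_norm_gt (h : X -> R) e : e < dual_norm h ->
  exists2 x, `|x| <= 1 & e < `|h x|.
Proof.
by move=> /sup_gt[|_ [x x1 <-] ex]; [exists `|h 0|, 0 => //=; rewrite normr0|exists x].
Qed.

Lemma norm_sublinear : sublinear (fun x : X => `|x|).
Proof.
split; first exact: ler_normD.
by move=> t x t0; rewrite normrZ ger0_norm.
Qed.

(** Separation form of Hahn-Banach, applied below to the ray of one vector and to the nonnegative
    combinations of a finite sequence. *)
Lemma dual_ball_above_cone (C : set (X * R)) : convex_cone C ->
  (forall v s, C (v, s) -> s <= `|v|) ->
  exists2 f, dual_ball f & forall v s, C (v, s) -> s <= f v.
Proof.
move=> coneC Cn.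
have [p [sp pn pC]] := sublinear_below_cone norm_sublinear coneC Cn.
have [f fp] := hahn_banach sp.
have fn x : f x <= `|x| := le_trans (fp x) (pn x).
exists f.
  by apply/dual_ballP => x; rewrite ler_norml fn andbT lerNl -linearN -normrN fn.
by move=> v s /pC pv; have := le_trans (fp (- v)) pv; rewrite linearN lerN2.
Qed.

Lemma norming_functional x : exists2 f, dual_ball f & f x = `|x|.
Proof.
have [||f f1 fC] := @dual_ball_above_cone
  [set vs | exists2 t, 0 <= t & vs = (t *: x, t * `|x|)].
- split.
  + by exists 0; rewrite ?scale0r ?mul0r.
  + move=> _ _ [t t0 ->] [u u0 ->]; exists (t + u); first exact: addr_ge0.
    by rewrite scalerDl mulrDl.
  + move=> t _ _ t0 [u u0 [-> ->]]; exists (t * u); first by rewrite mulr_ge0// ltW.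
    by rewrite scalerA mulrA.
- by move=> _ _ [t t0 [-> ->]]; rewrite normrZ ger0_norm.
exists f => //; apply/le_anti/andP; split.
  by apply: le_trans (ler_norm _) _; move/dual_ballP : f1; exact.
by apply: fC; exists 1; rewrite ?scale1r ?mul1r.
Qed.

End dual.

(** * Weak* compactness and a closed Szlenk derivation *)

Lemma finite_nat_bound (A : set nat) : finite_set A ->
  exists N, forall n, A n -> (n < N)%N.
Proof.
move=> /finite_seqP[s ->]; exists (\max_(i <- s) i).+1 => n /= ns.
by rewrite ltnS; exact: leq_bigmax_seq.
Qed.

Lemma finite_inj_image (T U : Type) (f : T -> U) (A : set T) :
  (forall x y, A x -> A y -> f x = f y -> x = y) ->
  finite_set (f @` A) -> finite_set A.
Proof.
move=> finj; apply: card_le_finite; suff /card_eqPle[] : f @` A #= A by [].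
by apply: inj_card_eq => x y /set_mem Ax /set_mem Ay; exact: finj.
Qed.

Section weak_star.
Variables (R : realType) (X : completeNormedModType R).
Implicit Types (f g h : {linear X -> R^o}) (x y : X) (P Q : set {linear X -> R^o}).

Definition near_on (l : seq X) (e : R) g f : Prop :=
  forall x, x \in l -> `|g x - f x| < e.

(** Banach-Alaoglu by an ultrafilter [G] finer than the tails: the values at each point converge
    along [G], the limit is linear in the point, and every set of [G] meets every tail. *)
Lemma dual_ball_cluster (f_ : nat -> {linear X -> R^o}) :
  (forall n, dual_ball (f_ n)) ->
  exists2 f, dual_ball f & forall l e N, 0 < e ->
    exists2 n, (N <= n)%N & near_on l e (f_ n) f.
Proof.
move=> f1; have fb n x : `|f_ n x| <= `|x| by move/dual_ballP: (f1 n); exact.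
have [G [GU sG]] := ultraFilterLemma (@eventually_filter).
have GF : ProperFilter G := ultra_proper.
have /choice[L LP] : forall x, exists L, forall e, 0 < e ->
    G [set n | `|f_ n x - L| < e].
  (* The limit along [G] is the supremum of the numbers that [G]-almost all values exceed or
     equal. *)
  move=> x; pose S := [set c | G [set n | c <= f_ n x]].
  have Sx : S (- `|x|).
    by apply: filterS filterT => n _ /=; have := fb n x; rewrite ler_norml => /andP[].
  have Sub : ubound S `|x|.
    move=> c /filter_ex[n /= cf]; apply: le_trans cf _.
    exact: le_trans (ler_norm _) (fb n x).
  have supS : has_sup S by split; [exists (- `|x|) | exists `|x|].
  exists (sup S) => e e0.
  have [c Sc cS] := sup_adherent e0 supS.
  have Ge : G (~` [set n | sup S + e <= f_ n x]).
    have [h|//] := @in_ultra_setVsetC _ G [set n | sup S + e <= f_ n x] GU.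
    by have := ub_le_sup (proj2 supS) h; rewrite gerDl leNgt e0.
  apply: filterS (filterI Sc Ge) => n [/= cn /negP]; rewrite -ltNge => nS.
  by rewrite ltr_norml ltrBlDr ltrBrDr addrC (lt_le_trans _ cn)//= addrC.
have LD t x y : L (t *: x + y) = t * L x + L y.
  apply/eqP; rewrite -subr_eq0 -normr_eq0; apply/eqP/le_anti; rewrite normr_ge0 andbT.
  apply/ler_addgt0Pl => e e0; rewrite addr0.
  have t1 : 0 < `|t| + 1 by rewrite ltr_wpDl.
  have e3 : 0 < e / 3 by rewrite divr_gt0.
  have et : 0 < e / 3 / (`|t| + 1) by rewrite divr_gt0.
  have [n [/= hxy [/= hx hy]]] :=
    filter_ex (filterI (LP (t *: x + y) _ e3) (filterI (LP x _ et) (LP y _ e3))).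
  move: hxy; rewrite linearD linearZ.
  have htx : `|t * (f_ n x - L x)| <= e / 3.
    rewrite normrM; apply: le_trans (ler_wpM2l _ (ltW hx)) _ => //.
    rewrite mulrA ler_pdivrMr// mulrC ler_wpM2l ?ltW//; lra.
  move: htx hy; rewrite !ler_norml !ltr_norml /= mulrBr.
  rewrite (_ : t *: f_ n x = t * f_ n x)//.
  move=> /andP[? ?] /andP[? ?] /andP[? ?]; apply/andP; split; lra.
pose m := GRing.isLinear.Build R X R^o *:%R (L : X -> R^o) LD.
pose f : {linear X -> R^o} := HB.pack (L : X -> R^o) m.
have LPl (l : seq X) e : 0 < e -> G [set n | near_on l e (f_ n) f].
  move=> e0; elim: l => [|x l IH]; first by apply: filterS filterT.
  apply: filterS (filterI (LP x e e0) IH) => n [/= hx hl] y.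
  by rewrite inE => /orP[/eqP->|]; [exact: hx | exact: hl].
exists f => [|l e N e0].
  apply/dual_ballP => x; apply/ler_addgt0Pl => e e0.
  have [n /= hn] := filter_ex (LP x e e0).
  change (`|L x| <= e + `|x|); rewrite -[L x](subrK (f_ n x)); apply: le_trans (ler_normD _ _) _.
  by rewrite distrC lerD// ltW.
have [n [nl nN]] := filter_ex (filterI (LPl l e e0) (sG _ (nbhs_infty_ge N))).
by exists n.
Qed.

Section closed_derivation.
Variable delta : R.

(** Two functionals near [f] and [delta] apart from each other replace a sequence staying away from
    [f]. This condition is weak* closed for any [Q]; the price is that only one of the two is known
    to be [delta / 2] away from [f]. *)
Definition wder Q : set {linear X -> R^o} :=
  [set f | dual_ball f /\ forall l e, 0 < e -> exists g h,
    [/\ Q g, Q h, near_on l e g f, near_on l e h f &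
        exists2 x, `|x| <= 1 & delta <= g x - h x]].

Definition wclosed Q : Prop := forall f, dual_ball f ->
  (forall l e, 0 < e -> exists2 g, Q g & near_on l e g f) -> Q f.

Lemma near_on_trans l e e' f g h : near_on l e f g -> near_on l e' g h ->
  near_on l (e + e') f h.
Proof.
move=> fg gh x xl; rewrite -(subrKA (g x)).
by apply: le_lt_trans (ler_normD _ _) _; rewrite ltrD ?fg ?gh.
Qed.

Lemma wder_mono P Q : P `<=` Q -> wder P `<=` wder Q.
Proof.
move=> PQ f [f1 fP]; split => // l e e0; have [g [h [Pg Ph gf hf x]]] := fP l e e0.
by exists g, h; split => //; exact: PQ.
Qed.

Lemma wder_ball Q : wder Q `<=` @dual_ball R X.
Proof. by move=> f []. Qed.

Lemma wder_closed Q : wclosed (wder Q).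
Proof.
move=> f f1 fQ; split => // l e e0; have e2 : 0 < e / 2 by rewrite divr_gt0.
have [k [_ kQ] kf] := fQ l _ e2; have [g [h [Qg Qh gk hk x]]] := kQ l _ e2.
by exists g, h; split => //; rewrite [e]splitr; exact: near_on_trans kf.
Qed.

Lemma titer_wder_decreasing a b : (b <= a)%O ->
  titer wder (@dual_ball R X) a `<=` titer wder (@dual_ball R X) b.
Proof. exact: titer_decreasing wder_mono (@wder_ball _) a b. Qed.

Lemma titer_wder_ball a : titer wder (@dual_ball R X) a `<=` @dual_ball R X.
Proof. exact: titer_sub wder_mono (@wder_ball _) a. Qed.

(** This serves limit stages: a cluster point of functionals from stages rising to a limit lies in
    each stage below that limit. *)
Lemma titer_wder_closed a : wclosed (titer wder (@dual_ball R X) a).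
Proof.
elim/(well_founded_ind omega1_wf) : a => a IH.
case: (zero_succ_limit a) => [a0|[b ba]|la].
- by rewrite titer0.
- by rewrite (titerS _ _ ba); exact: wder_closed.
- rewrite titer_lim// => f f1 fQ b ba; apply: IH => // l e e0.
  by have [g Qg gf] := fQ l e e0; exists g => //; exact: Qg.
Qed.

End closed_derivation.

Lemma dense_seq : separable X -> exists d : nat -> X,
  forall x e, 0 < e -> exists n, `|x - d n| < e.
Proof.
move=> [D [/countable_injP[i iinj] Dd]].
have /choice[d dP] : forall n, exists x, forall y, D y -> i y = n -> y = x.
  move=> n; case: (pselect (exists2 y, D y & i y = n)) => [[y Dy iy]|ny].
    by exists y => z Dz iz; apply: iinj; rewrite ?inE// iy.
  by exists 0 => z Dz iz; case: ny; exists z.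
exists d => x e e0.
have [|y [/= xy Dy]] := Dd (ball x e) _ (ball_open x e).
  by exists x; exact: ballxx.
by exists (i y); rewrite -(dP _ y Dy erefl); move: xy; rewrite -ball_normE.
Qed.

Lemma szlenk_step_mono eps P Q : P `<=` Q -> szlenk_step eps P `<=` szlenk_step eps Q.
Proof.
move=> PQ f [f1 [f_ [Pf ff fe]]]; split => //; exists f_; split => // m.
exact: PQ.
Qed.

Lemma szlenk_step_ball eps Q : szlenk_step eps Q `<=` @dual_ball R X.
Proof. by move=> f []. Qed.

Lemma szlenk_set_decreasing eps a b : (b <= a)%O ->
  @szlenk_set R X eps a `<=` szlenk_set eps b.
Proof.
rewrite /szlenk_set; exact: titer_decreasing (@szlenk_step_mono eps)
  (@szlenk_step_ball eps _) a b.
Qed.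

Lemma szlenk_set_ball eps a : @szlenk_set R X eps a `<=` @dual_ball R X.
Proof.
rewrite /szlenk_set; exact: titer_sub (@szlenk_step_mono eps) (@szlenk_step_ball eps _) a.
Qed.

Lemma dual_ball_diff f g x : dual_ball f -> dual_ball g -> `|f x - g x| <= 2 * `|x|.
Proof.
move=> /dual_ballP/(_ x) fx /dual_ballP/(_ x) gx.
by apply: le_trans (ler_normB _ _) _; rewrite mulr_natl mulr2n lerD.
Qed.

Lemma dual_ball_near f g x y : dual_ball f -> dual_ball g ->
  `|f x - g x| <= `|f y - g y| + 2 * `|x - y|.
Proof.
move=> f1 g1; have split_x h : h x = h y + h (x - y) by rewrite -linearD subrKC.
rewrite (split_x f) (split_x g) opprD addrACA.
apply: le_trans (ler_normD _ _) _; rewrite lerD2l; exact: dual_ball_diff.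
Qed.

(** Functionals of the ball are equi-Lipschitz, so closeness on ever longer initial parts of a dense
    sequence is enough. *)
Lemma weak_star_cvg_dense (d : nat -> X) (f_ : nat -> {linear X -> R^o}) f :
  (forall x e, 0 < e -> exists n, `|x - d n| < e) ->
  (forall n, dual_ball (f_ n)) -> dual_ball f ->
  (forall n, near_on (mkseq d n) n.+1%:R^-1 (f_ n) f) -> weak_star_cvg f_ f.
Proof.
move=> dd f_1 f1 fd x; apply/cvgrPdistC_lt => e e0.
have e4 : 0 < e / 4 by rewrite divr_gt0.
have [k xk] := dd x _ e4.
have e2 : 0 < e / 2 by rewrite divr_gt0.
near=> n.
have dk : d k \in mkseq d n.
  by apply/mapP; exists k => //; rewrite mem_iota/= add0n; near: n; exact: nbhs_infty_gt.
apply: le_lt_trans (dual_ball_near x (d k) (f_1 n) f1) _.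
have h2 := fd n _ dk.
have h3 : n.+1%:R^-1 < e / 2 by near: n; exact: near_infty_natSinv_lt (PosNum e2).
rewrite [e]splitr; apply: ltrD (lt_trans h2 h3) _.
by move: xk; clear; lra.
Unshelve. all: by end_near. Qed.

(** Of the two functionals given by [wder], one is [delta / 2] away from [f]. Choosing it near [f]
    on the first [n] dense points produces the convergent sequence that a Szlenk step asks for. *)
Lemma wder_sub_szlenk delta a : separable X -> 0 < delta ->
  titer (wder delta) (@dual_ball R X) a `<=` szlenk_set (delta / 2) a.
Proof.
move=> /dense_seq[d dd] d0; elim/(well_founded_ind omega1_wf) : a => a IH.
rewrite /szlenk_set; case: (zero_succ_limit a) => [a0|[b ba]|la].
- by rewrite !titer0.
- rewrite !(titerS _ _ ba) => f [f1 fQ]; split => //.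
  have /choice[g gP] : forall n, exists g, [/\ szlenk_set (delta / 2) b g,
      near_on (mkseq d n) n.+1%:R^-1 g f & delta / 2 <= dual_norm (g \- f)].
    move=> n; have n0 : 0 < n.+1%:R^-1 :> R by rewrite invr_gt0.
    have [g [h [Qg Qh gf hf [x x1 ghx]]]] := fQ (mkseq d n) _ n0.
    have H k : titer (wder delta) (@dual_ball R X) b k ->
        `|(k \- f) x| <= dual_norm (k \- f).
      move=> /titer_wder_ball k1; apply: (@dual_norm_ge _ _ _ 2) => // y y1.
      by apply: le_trans (dual_ball_diff y k1 f1) _; lra.
    have := H _ Qg; have := H _ Qh; rewrite /= => hx gx.
    have [|] := leP (delta / 2) (dual_norm (g \- f)).
      by exists g; split => //; exact: IH ba.1 _ Qg.
    move=> gx'; exists h; split => //; first exact: IH ba.1 _ Qh.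
    have := ler_norm (g x - f x); have := ler_norm (- (h x - f x)); rewrite normrN.
    lra.
  exists g; split => [n||]; first by case: (gP n).
    apply: (weak_star_cvg_dense dd) => // n; last by case: (gP n).
    by apply: szlenk_set_ball; case: (gP n) => + _ _; exact.
  rewrite limn_einf_lim; apply: lime_ge; first exact: is_cvg_einfs.
  apply: nearW => n; apply: le_ereal_inf_tmp => _ [m _ <-].
  by rewrite lee_fin; case: (gP m).
- by rewrite !titer_lim// => f fQ b ba; apply: IH => //; exact: fQ.
Qed.

End weak_star.

(** * Rosenthal's l_1 theorem *)

Section rosenthal_sets.
Variables (S : Type) (A B : nat -> set S).
Implicit Types (M N : set nat) (C : set S) (L : seq (set S)).

(** In the application [A n] and [B n] say that a functional at the [n]-th vector is above [q],
    respectively below [p]; the condition excludes infinite oscillation across the gap. *)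
Definition conv_on M C : Prop := forall t, C t ->
  finite_set (M `&` [set n | A n t]) \/ finite_set (M `&` [set n | B n t]).

Definition nowhere_conv_on M C : Prop :=
  forall N, N `<=` M -> infinite_set N -> ~ conv_on N C.

Definition side (b : bool) := if b then A else B.

Lemma infinite_gt M k : infinite_set M -> infinite_set (M `&` [set n | (k < n)%N]).
Proof.
move=> iM fM; apply: iM.
have : finite_set ((M `&` [set n | (k < n)%N]) `|` `I_k.+1).
  by rewrite finite_setU; split => //; exact: finite_II.
apply: sub_finite_set => n Mn; case: (ltnP k n) => kn; first by left.
by right.
Qed.

(* Otherwise every [j] in [M] has a further subset converging on some [C `&` A j]
   or [C `&` B j].  Diagonalize and keep the [j]s with the same [C] and the same
   side, say [A]: they converge on all of [C], since a point outside every [A j]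
   is trivially a point of convergence. *)
Lemma rosenthal_step L M : infinite_set M ->
  (forall C, C \in L -> nowhere_conv_on M C) ->
  exists j N, [/\ M j, N `<=` M `&` [set n | (j < n)%N], infinite_set N &
    forall C b, C \in L -> nowhere_conv_on N (C `&` side b j)].
Proof.
move=> iM ML; apply: contrapT => no.
(* A record [r] holds the index [j], the set and side that spoil it, and the infinite subset
   converging there. *)
have spoil (N : {N | N `<=` M /\ infinite_set N}) :
    exists r : nat * (set S * bool) * {N | N `<=` M /\ infinite_set N},
    [/\ sval N r.1.1, r.1.2.1 \in L,
        sval r.2 `<=` sval N `&` [set n | (r.1.1 < n)%N] &
        conv_on (sval r.2) (r.1.2.1 `&` side r.1.2.2 r.1.1)].
  case: N => N [NM iN] /=; have [j Nj] := infinite_setN0 iN.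
  apply: contrapT => nor; apply: no; exists j, (N `&` [set n | (j < n)%N]).
  split; first exact: NM; [by move=> n [/NM]|exact: infinite_gt|].
  move=> C b CL N' N'N iN' N'C; apply: nor.
  have N'P : N' `<=` M /\ infinite_set N' by split => // n /N'N[/NM].
  by exists ((j, (C, b)), exist _ N' N'P).
have [g gP] := choice spoil.
pose N := fix N k := if k is l.+1 then (g (N l)).2
  else exist (fun N => N `<=` M /\ infinite_set N) M (conj (@subset_refl _ M) iM).
pose j k := (g (N k)).1.1; pose c k := (g (N k)).1.2.
have NS k l : (k < l)%N -> sval (N l) `<=` sval (N k.+1).
  elim: l => [//|l IH]; rewrite ltnS leq_eqVlt => /orP[/eqP->//|kl].
  by apply: subset_trans (IH kl) => n /=; case: (gP (N l)) => _ _ /[swap] _ /[apply] -[].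
have jN k l : (k < l)%N -> sval (N k.+1) (j l).
  by move=> kl; apply: (NS _ _ kl); case: (gP (N l)).
have jlt k l : (k < l)%N -> (j k < j l)%N.
  by move=> /jN; case: (gP (N k)) => _ _ h _ /h[].
have jinj k l : j k = j l -> k = l.
  by move=> jkl; case: (ltngtP k l) => // /jlt; rewrite jkl ltnn.
have [C [b [CL iC]]] : exists C b, C \in L /\ infinite_set [set k | c k = (C, b)].
  apply: contrapT => nC; apply: infinite_nat.
  have : finite_set (\bigcup_(Cb in [set` L] `*` [set: bool]) [set k | c k = Cb]).
    apply: bigcup_finite.
      by apply: finite_setX; [exact: finite_seq | exact: finite_finset].
    move=> [C b] [/= CL _]; apply: contrapT => iC; apply: nC; by exists C, b.
  apply: sub_finite_set => k _; exists (c k) => //; split => //.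
  by case: (gP (N k)).
pose J := j @` [set k | c k = (C, b)].
have iJ : infinite_set J.
  by move=> fJ; apply: iC; apply: finite_inj_image fJ => k l _ _; exact: jinj.
have JM : J `<=` M.
  by move=> _ [k _ <-]; have [Nj _ _ _] := gP (N k); exact: (proj1 (proj2_sig (N k))).
apply: (ML C CL J JM iJ) => t Ct; apply: contrapT => /not_orP[iA iB].
have iS b' : infinite_set (J `&` [set n | side b' n t]) by case: b'.
(* A point [t] of oscillation is in [side b (j k)] for some [k], where the set of stage [k.+1]
   converges; all but finitely many elements of [J] lie in that set, a contradiction. *)
have [_ [[k kC <-] kt]] := infinite_setN0 (iS b).
have [_ _ _] := gP (N k); rewrite -/(c k) kC /= => Nc.
have [b' fN] : exists b', finite_set (sval (N k.+1) `&` [set n | side b' n t]).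
  by case: (Nc t (conj Ct kt)) => h; [exists true | exists false].
apply: (iS b').
have : finite_set ((sval (N k.+1) `&` [set n | side b' n t]) `|` j @` `I_k.+1).
  by rewrite finite_setU; split => //; apply: finite_image; exact: finite_II.
apply: sub_finite_set => _ [[l _ <-] lt]; case: (ltnP k l) => kl.
  by left; split => //; exact: jN.
by right; exists l.
Qed.

(** Iterating the step, the list carries all intersections of [C0] with choices of sides. Each is
    nowhere convergent, hence nonempty, because on the empty set everything converges. *)
Lemma rosenthal_independent M C0 : infinite_set M -> nowhere_conv_on M C0 ->
  exists j : nat -> nat, forall (sg : nat -> bool) n,
    exists2 t, C0 t & forall k, (k < n)%N -> side (sg k) (j k) t.
Proof.
move=> iM MC0.
pose good (s : seq (set S) * set nat) :=
  infinite_set s.2 /\ forall C, C \in s.1 -> nowhere_conv_on s.2 C.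
have next (s : {s | good s}) : exists r : nat * {s | good s},
    (sval r.2).1 = [seq C `&` A r.1 | C <- (sval s).1] ++
                   [seq C `&` B r.1 | C <- (sval s).1].
  case: s => -[L N] [/= iN NL]; have [j [N' [_ N'N iN' N'L]]] := rosenthal_step iN NL.
  pose L' := [seq C `&` A j | C <- L] ++ [seq C `&` B j | C <- L].
  suff gL : good (L', N').
    by exists (j, exist _ (L', N') gL).
  split => // C; rewrite mem_cat => /orP[] /mapP[C' C'L ->].
    exact: (N'L C' true).
  exact: (N'L C' false).
have [g gP] := choice next.
have g0 : good ([:: C0], M) by split => // C; rewrite inE => /eqP->.
pose s := fix s k := if k is l.+1 then (g (s l)).2 else exist good ([:: C0], M) g0.
exists (fun k => (g (s k)).1) => sg n.
have [C [CL Csg]] : exists C, C \in (sval (s n)).1 /\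
    forall t, C t -> C0 t /\ forall k, (k < n)%N -> side (sg k) (g (s k)).1 t.
  elim: n => [|n [C [CL Csg]]]; first by exists C0; rewrite inE eqxx.
  exists (C `&` side (sg n) (g (s n)).1); split.
    rewrite /= gP mem_cat; apply/orP; case: (sg n); [left|right];
      by apply/mapP; exists C.
  move=> t [/Csg[C0t Ct] tn]; split => // k; rewrite ltnS leq_eqVlt.
  by move=> /orP[/eqP->//|]; exact: Ct.
have [iN NL] := proj2_sig (s n).
have [t Ct] : C !=set0.
  apply: contrapT => nC; apply: (NL _ CL _ (@subset_refl _ _) iN) => t Ct.
  by case: nC; exists t.
by exists t; [case: (Csg t Ct) | case: (Csg t Ct)].
Qed.

End rosenthal_sets.

(** * Weakly Cauchy subsequences *)

Section rosenthal_ell1.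
Variables (R : realType) (X : completeNormedModType R).
Implicit Types (u w : nat -> X) (f : {linear X -> R^o}).

Lemma ell1_embedding w d : 0 < d -> (forall n, `|w n| <= 1) ->
  (forall (a : nat -> R) n,
    d * \sum_(0 <= k < n) `|a k| <= `|\sum_(0 <= k < n) a k *: w k|) ->
  contains_ell1 X.
Proof.
move=> d0 w1 wd; pose v (a : R^nat) k := a k *: w k.
have v_le a k : `|v a k| <= `|a k| by rewrite normrZ ler_piMr.
have nv_cvg a : ell1 a -> cvgn [normed series (v a)].
  by move=> ca; apply: series_le_cvg ca => k; rewrite ?normr_ge0//; exact: v_le.
have v_cvg a : ell1 a -> cvgn (series (v a)) by move=> /nv_cvg; exact: normed_cvg.
exists (fun a => limn (series (v a))); split.
  move=> r a b /v_cvg ca /v_cvg cb; apply/cvg_lim => //.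
  rewrite (_ : series _ = r \*: series (v a) \+ series (v b)); last first.
    apply: funext => n; rewrite /series /= scaler_sumr -big_split /=.
    by apply: eq_bigr => k _; rewrite /v scalerDl scalerA.
  by apply: cvgD => //; apply: cvgZr.
exists d, 1; split => // a la; have ca := v_cvg _ la.
have cna : (fun n => `|series (v a) n|) @ \oo --> `|limn (series (v a))|.
  exact: cvg_norm.
rewrite mul1r; apply/andP; split.
  have cda : (fun n => d * [normed series a] n) @ \oo --> d * ell1_norm a.
    by apply: cvgM => //; exact: cvg_cst.
  by apply: ler_cvg_to cda cna _; apply: nearW => n; exact: wd.
apply: ler_cvg_to cna la _; apply: nearW => n.
apply: le_trans (ler_norm_sum _ _ _) _.
by apply: ler_sum => k _; exact: v_le.
Qed.

(** The limit is the upper limit, [sup S]. Infinitely many terms near it put infinitely many above a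
    rational [q], so only finitely many can lie below a slightly smaller rational [p]. *)
Lemma bounded_real_cvg (v : R^nat) : (forall n, `|v n| <= 1) ->
  (forall p q : rat, p < q -> finite_set [set n | ratr q < v n] \/
                              finite_set [set n | v n < ratr p]) ->
  cvgn v.
Proof.
move=> v1 vpq; pose S := [set c | infinite_set [set n | c <= v n]].
have S1 : S (- 1).
  rewrite /S /= (_ : [set n | _] = setT); first exact: infinite_nat.
  by apply/seteqP; split => // n _ /=; have := v1 n; rewrite ler_norml => /andP[].
have Sub : ubound S 1.
  move=> c /infinite_setN0[n /= cn]; apply: le_trans cn _.
  by have := v1 n; rewrite ler_norml => /andP[].
have supS : has_sup S by split; [exists (- 1) | exists 1].
suff : v @ \oo --> sup S by move=> h; apply/cvg_ex; exists (sup S).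
apply/cvgrPdistC_lt => e e0.
have fin_near (P : set nat) : finite_set P -> \forall n \near \oo, ~ P n.
  move=> /finite_nat_bound[N NP]; exists N => // n /= Nn /NP; by rewrite ltnNge Nn.
have fhi : finite_set [set n | sup S + e <= v n].
  apply: contrapT => h.
  by have := ub_le_sup (proj2 supS) h; rewrite gerDl leNgt e0.
have flo : finite_set [set n | v n <= sup S - e].
  have e2 : 0 < e / 2 by rewrite divr_gt0.
  have [c Sc cS] := sup_adherent e2 supS.
  have ec : sup S - e < c by apply: lt_trans cS; rewrite ltrD2l ltrN2; lra.
  have [p] := rat_in_itvoo ec; rewrite in_itv/= => /andP[ep pc].
  have [q] := rat_in_itvoo pc; rewrite in_itv/= => /andP[pq qc].
  have pq' : p < q by rewrite -(ltr_rat R).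
  have [fq|] := vpq p q pq'.
    exfalso; apply: Sc; apply: sub_finite_set fq => n /=; exact: lt_le_trans.
  by apply: sub_finite_set => n /= vn; exact: le_lt_trans vn ep.
have [nhi nlo] := (fin_near _ fhi, fin_near _ flo).
near=> n.
have : ~ (sup S + e <= v n) by near: n; exact: nhi.
have : ~ (v n <= sup S - e) by near: n; exact: nlo.
move=> /negP; rewrite -ltNge => h1 /negP; rewrite -ltNge => h2.
rewrite ltr_norml; apply/andP; split; lra.
Unshelve. all: by end_near. Qed.

(** For one gap [p < q], failure on every infinite index set gives independent sides and thus a copy
    of l_1. A diagonal sequence then handles all rational gaps at once. *)
Theorem rosenthal u : ~ contains_ell1 X -> (forall n, `|u n| <= 1) ->
  exists ph : nat -> nat, (forall m n, (m < n)%N -> (ph m < ph n)%N) /\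
    forall f, dual_ball f -> cvgn (fun n => f (u (ph n)) : R).
Proof.
move=> nl1 u1.
pose A (q : R) n := [set f : {linear X -> R^o} | q < f (u n)].
pose B (p : R) n := [set f : {linear X -> R^o} | f (u n) < p].
have extract (p q : R) M : p < q -> infinite_set M ->
    exists N, [/\ N `<=` M, infinite_set N & conv_on (A q) (B p) N (@dual_ball R X)].
  move=> pq iM; apply: contrapT => no; apply: nl1.
  have [|j jP] := @rosenthal_independent _ (A q) (B p) M (@dual_ball R X) iM.
    by move=> N NM iN cN; apply: no; exists N.
  apply: (@ell1_embedding (fun k => u (j k)) ((q - p) / 2)) => //.
    by rewrite divr_gt0 ?subr_gt0.
  (* Sides following the signs of the coefficients for [f], and the opposite sides for [g], make
     each term contribute at least [(q - p) * |a k|] to [f s - g s]. *)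
  move=> a n; have [f f1 fP] := jP (fun k => 0 <= a k) n.
  have [g g1 gP] := jP (fun k => ~~ (0 <= a k)) n.
  set s := \sum_(0 <= k < n) _ *: _.
  suff h : (q - p) * \sum_(0 <= k < n) `|a k| <= f s - g s.
    have := le_trans h (le_trans (ler_norm _) (dual_ball_diff s f1 g1)).
    lra.
  have fsE (h : {linear X -> R^o}) : h s = \sum_(0 <= k < n) a k * h (u (j k)) :> R.
    by rewrite linear_sum; apply: eq_bigr => k _; rewrite linearZ.
  rewrite !fsE -sumrB mulr_sumr big_nat [leRHS]big_nat; apply: ler_sum => k /andP[_ kn].
  rewrite -mulrBr; have := fP k kn; have := gP k kn; rewrite /side /A /B.
  case: (leP 0 (a k)) => ak /= hg hf.
    by rewrite ger0_norm// [leLHS]mulrC; apply: ler_wpM2l => //; lra.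
  rewrite ltr0_norm// mulrC mulNr -mulrN; apply: ler_wnM2l; first exact: ltW.
  lra.
pose e k : rat * rat := odflt (0, 1) (unpickle k).
have /choice[g gP] : forall kM : nat * {M : set nat | infinite_set M},
    exists N : {M : set nat | infinite_set M}, sval N `<=` sval kM.2 /\
    ((e kM.1).1 < (e kM.1).2 ->
     conv_on (A (ratr (e kM.1).2)) (B (ratr (e kM.1).1)) (sval N) (@dual_ball R X)).
  move=> [k [M iM]] /=; case: (ltP (e k).1 (e k).2) => [pq|_]; last first.
    by exists (exist _ M iM); split.
  have [|N [NM iN cN]] := extract (ratr (e k).1) (ratr (e k).2) M _ iM.
    by rewrite ltr_rat.
  by exists (exist _ N iN).
pose M := fix M k : {M : set nat | infinite_set M} :=
  if k is l.+1 then g (l, M l) else exist _ setT infinite_nat.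
have Mdec k l : (k <= l)%N -> sval (M l) `<=` sval (M k).
  elim: l => [|l IH]; first by rewrite leqn0 => /eqP->.
  rewrite leq_eqVlt => /orP[/eqP->//|kl]; apply: subset_trans (IH kl).
  by have [] := gP (l, M l).
have /choice[nx nxP] : forall kn : nat * nat, exists m,
    sval (M kn.1) m /\ (kn.2 < m)%N.
  move=> [k n]; have [m [Mm nm]] := infinite_setN0 (infinite_gt (k := n) (proj2_sig (M k))).
  by exists m.
pose ph := fix ph k := if k is l.+1 then nx (l.+1, ph l) else nx (0, 0)%N.
have phM k : sval (M k) (ph k).
  by case: k => [|k]; [exact: (nxP (0, 0)%N).1 | exact: (nxP (k.+1, ph k)).1].
have phlt m n : (m < n)%N -> (ph m < ph n)%N.
  elim: n => [//|n IH]; rewrite ltnS leq_eqVlt => /orP[/eqP->|/IH mn].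
    by case: (nxP (n.+1, ph n)).
  by apply: ltn_trans mn _; case: (nxP (n.+1, ph n)).
have phinj k l : ph k = ph l -> k = l.
  by move=> kl; case: (ltngtP k l) => // /phlt; rewrite kl ltnn.
exists ph; split => // f f1; apply: bounded_real_cvg => [n|p q pq].
  by apply: le_trans (u1 (ph n)); move/dual_ballP : f1; exact.
pose k := pickle (p, q).
have ek : e k = (p, q) by rewrite /e pickleK.
(* Pair number [k] is treated in passing from [M k] to [M k.+1], hence the shift. *)
have cN : conv_on (A (ratr q)) (B (ratr p)) (sval (M k.+1)) (@dual_ball R X).
  clearbody k; case: (gP (k, M k)) => _ /=; rewrite ek; exact.
clearbody k.
have fin (P : set nat) : finite_set (sval (M k.+1) `&` P) ->
    finite_set [set n | P (ph n)].
  move=> fP; have : finite_set ((sval (M k.+1) `&` P) `|` ph @` `I_k.+1).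
    by rewrite finite_setU; split => //; apply: finite_image; exact: finite_II.
  move=> fU; apply: (@finite_inj_image _ _ ph); first by move=> k' l _ _; exact: phinj.
  apply: sub_finite_set fU => _ [n /= Pn <-]; case: (ltnP k n) => kn.
    by left; split => //; apply: (Mdec k.+1 n kn); exact: phM.
  by right; exists n.
by case: (cN f f1) => /fin; [left | right].
Qed.

End rosenthal_ell1.

(** * Labellings of T(a,s) *)

Section labels.
Variable E : eqType.
Implicit Types (phi : seq nat -> E) (s : seq nat).

(** This is the branch of labels at the successive nonempty initial segments of [s]. *)
Fixpoint labels phi s : seq E :=
  if s is n :: s' then phi [:: n] :: labels (fun t => phi (n :: t)) s' else [::].

Lemma size_labels phi s : size (labels phi s) = size s.
Proof. by elim: s phi => //= n s IH phi; rewrite IH. Qed.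

Lemma labels_rcons phi s n :
  labels phi (rcons s n) = rcons (labels phi s) (phi (rcons s n)).
Proof. by elim: s phi => //= m s IH phi; rewrite IH. Qed.

Lemma take_labels phi s i : take i (labels phi s) = labels phi (take i s).
Proof. by elim: s phi i => //= n s IH phi [|i] //=; rewrite IH. Qed.

Lemma eq_labels phi psi s : (forall t, t <> [::] -> phi t = psi t) ->
  labels phi s = labels psi s.
Proof.
elim: s phi psi => //= n s IH phi psi e; rewrite e//; congr (_ :: _).
by apply: IH => t _; exact: e.
Qed.

End labels.

(** At a limit, this pulls a labelling back to the [n]-th copy. *)
Definition relabel (E : Type) (phi : seq nat -> E) (n : nat) (s : seq nat) : E :=
  if s is k :: s' then phi (pickle (n, k) :: s') else phi [::].

Lemma prefix_rconsP (E : eqType) (s t : seq E) x :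
  prefix s (rcons t x) -> s = rcons t x \/ prefix s t.
Proof.
move=> /prefixP[w]; case: (lastP w) => [|w' y]; first by rewrite cats0 => ->; left.
rewrite -rcons_cat => /rcons_inj[-> _]; right; exact: prefix_prefix.
Qed.

Section labelled_trees.
Variables (R : realType) (X : completeNormedModType R).
Variable fs : omega1 -> nat -> omega1.
Hypothesis hfs : fundamental fs.
Implicit Types (phi : seq nat -> X) (p : seq X).

(** Counting the siblings with a large value avoids choosing an enumeration of them. *)
Definition weakly_null_labels a phi : Prop :=
  forall q (f : {linear X -> R^o}) d, continuous f -> 0 < d ->
    finite_set [set n | Ts fs a (rcons q n) /\ d <= `|f (phi (rcons q n))|].

(** The list [p] collects the labels below the subtree in hand, so the induction retains one
    functional large on whole branches. *)
Lemma labelled_tree_wder c a p phi : 0 < c -> weakly_null_labels a phi ->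
  (forall s, Ts fs a s -> `|phi s| <= 1) ->
  (forall s, s = [::] \/ Ts fs a s ->
    exists2 g : {linear X -> R^o}, dual_ball g &
      forall x, x \in p ++ labels phi s -> c <= g x) ->
  exists2 f : {linear X -> R^o}, titer (wder (c / 2)) (@dual_ball R X) a f &
    forall x, x \in p -> c <= f x.
Proof.
move=> c0; elim/(well_founded_ind omega1_wf) : a p phi => a IH p phi wn u1 br.
have cl_ge (f_ : nat -> {linear X -> R^o}) (f : {linear X -> R^o}) :
    (forall n x, x \in p -> c <= f_ n x) ->
    (forall l e N, 0 < e -> exists2 n, (N <= n)%N & near_on l e (f_ n) f) ->
    forall x, x \in p -> c <= f x.
  move=> f_c fcl x xp; apply/ler_addgt0Pl => e e0.
  have [n _ fn] := fcl [:: x] e 0%N e0.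
  have := fn x (mem_head _ _); have := f_c n x xp.
  by rewrite ltr_norml => ? /andP[? ?]; lra.
case: (zero_succ_limit a) => [a0|[b ba]|la].
- have [|g g1 gc] := br [::]; first by left.
  exists g; first by rewrite titer0.
  by move=> x xp; apply: gc; rewrite cats0.
- have /choice[f_ f_P] : forall n, exists f : {linear X -> R^o},
      titer (wder (c / 2)) (@dual_ball R X) b f /\
      forall x, x \in rcons p (phi [:: n]) -> c <= f x.
    move=> n; have [|||f Qf fc] // := IH b ba.1 (rcons p (phi [:: n])) (fun t => phi (n :: t)).
    + move=> q f d fc d0; apply: sub_finite_set (wn (n :: q) f d fc d0) => m /= [Tm dm].
      by split => //; exact: Ts_succ ba Tm.
    + by move=> s Ts_s; apply: u1; exact: Ts_succ ba Ts_s.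
    + move=> s sT; have [|g g1 gc] := br (n :: s).
        by right; apply/(Ts_succE _ _ _ ba).
      by exists g => // x; rewrite cat_rcons => xp; exact: gc.
    by exists f.
  have f_1 n := titer_wder_ball (f_P n).1.
  have [f f1 fcl] := dual_ball_cluster f_1.
  have y1 n : `|phi [:: n]| <= 1 by apply: u1; exact: Ts_init ba.
  exists f; last first.
    by apply: (cl_ge f_) => // n x xp; apply: (f_P n).2; rewrite mem_rcons inE xp orbT.
  rewrite (titerS _ _ ba); split => // l e e0.
  (* With [y] the label at [n], [f y] is below [c / 4] and [f_ m y] is within [c / 4] of it, while
     [f_ n y >= c]; so [f_ n] and [f_ m] differ by [c / 2] at [y]. *)
  have c4 : 0 < c / 4 by rewrite divr_gt0.
  have [N NP] := finite_nat_bound (wn [::] f _ (proj1 f1) c4).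
  have [n Nn fn] := fcl l e N e0.
  have fy : `|f (phi [:: n])| < c / 4.
    rewrite ltNge; apply/negP => cf; have := NP n; rewrite ltnNge Nn => h.
    by have := h (conj (Ts_init fs n ba) cf).
  have ee0 : 0 < Num.min e (c / 4) by rewrite lt_min e0.
  have [m _ fm] := fcl (phi [:: n] :: l) _ 0%N ee0.
  exists (f_ n), (f_ m); split; first exact: (f_P n).1; first exact: (f_P m).1.
  + by [].
  + move=> x xl; have := fm x; rewrite inE xl orbT lt_min => /(_ isT)/andP[].
    by [].
  + exists (phi [:: n]) => //.
    have := fm (phi [:: n]); rewrite inE eqxx lt_min => /(_ isT)/andP[_].
    have : c <= f_ n (phi [:: n]) by apply: (f_P n).2; rewrite mem_rcons mem_head.
    move: fy; rewrite !ltr_norml => /andP[? ?] ? /andP[? ?]; lra.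
- have [fsS _ fsa fsb] := hfs la.
  have /choice[f_ f_P] : forall n, exists f : {linear X -> R^o},
      titer (wder (c / 2)) (@dual_ball R X) (fs a n) f /\
      forall x, x \in p -> c <= f x.
    move=> n; have [|||f Qf fc] // := IH _ (fsa n) p (relabel phi n).
    + move=> [|k q] f d fc d0.
        have := wn [::] f d fc d0 => /=.
        move=> /finite_nat_bound[N NP].
        apply: (@sub_finite_set _ _ [set k | (pickle (n, k) < N)%N]).
          move=> k /= [Tk dk]; apply: NP; split => //.
          exact: Ts_limit Tk.
        have : finite_set ((fun m => if (unpickle m : option (nat * nat)) is Some nk
          then nk.2 else 0%N) @` `I_N) by apply: finite_image; exact: finite_II.
        apply: sub_finite_set => k /= kN; exists (pickle (n, k)) => //.
        by rewrite pickleK.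
      apply: sub_finite_set (wn (pickle (n, k) :: q) f d fc d0) => m /= [Tm dm].
      by split => //; exact: Ts_limit Tm.
    + by move=> [/Ts_nil//|k s] Ts_s; apply: u1; exact: Ts_limit Ts_s.
    + move=> [|k s] sT; first exact: br [::] (or_introl erefl).
      have [|g g1 gc] := br (pickle (n, k) :: s).
        by right; case: sT => // sT; exact: Ts_limit sT.
      by exists g.
    by exists f.
  have f_1 n := titer_wder_ball (f_P n).1.
  have [f f1 fcl] := dual_ball_cluster f_1.
  exists f; last by apply: (cl_ge f_) => // n x xp; apply: (f_P n).2.
  rewrite titer_lim// => b /= ba; have [n0 bn0] := fsb _ ba.
  (* From [n0] on, every [f_ n] belongs to stage [b], so its cluster point does too. *)
  apply: titer_wder_closed => // l e e0.
  have [n n0n fn] := fcl l e n0 e0; exists (f_ n) => //.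
  apply: titer_wder_decreasing (f_P n).1.
  exact: le_trans (ltW bn0) (fundamental_mono hfs la n0n).
Qed.

Lemma Ts_rcons a q n : Ts fs a (rcons q n) -> q = [::] \/ Ts fs a q.
Proof.
case: q => [|m q] h; [by left | right].
have := Ts_prefix h (ltn0Sn (size q)).
by rewrite -[(size q).+1]/(size (m :: q)) -cats1 take_size_cat.
Qed.

(** An order isomorphism respects immediate predecessors, and in [T] these are obtained by dropping
    the last entry. Hence the last entries of the images determine the isomorphism. *)
Lemma tree_iso_labels T a : tree_on T -> tree_iso T (Ts fs a) ->
  (forall p v, p <> [::] -> T (rcons p v) -> T p) ->
  exists phi : seq nat -> X,
    set_bij (Ts fs a) T (labels phi).
Proof.
move=> [_ T0] /tree_iso_sym[g [[gfun ginj gsurj] gpre]] Tpar.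
have gI s t : Ts fs a s -> Ts fs a t -> g s = g t -> s = t.
  by move=> sT tT; apply: ginj; rewrite inE.
pose phi s := last 0 (g s); exists phi.
suff gE s : Ts fs a s -> labels phi s = g s.
  split=> [s sT /=|s t /set_mem sT /set_mem tT|t /gsurj[s sT <-]].
  - by rewrite gE//; exact: gfun.
  - by rewrite !gE//; exact: gI.
  - by exists s => //; exact: gE.
elim/last_ind: s => [/Ts_nil//|q n IH] sT; rewrite labels_rcons /phi.
have := gfun _ sT; move gs : (g (rcons q n)) => w.
case: (lastP w) gs => [//|u x] gs gsT.
rewrite last_rcons; congr rcons.
have uT : u <> [::] -> exists t, [/\ Ts fs a t, g t = u & prefix t q].
  move=> u0; have [t tT gt] := gsurj _ (Tpar _ _ u0 gsT); exists t; split => //.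
  have : prefix t (rcons q n) by rewrite -gpre// gt gs -cats1 prefix_prefix.
  move=> /prefix_rconsP[tE|//].
  by move: gs; rewrite -tE gt => /(congr1 size); rewrite size_rcons => /n_Sn.
have [qE|Tq] := Ts_rcons sT.
  rewrite qE; case: u {gs gsT} uT => // y u [//|t [tT _]].
  by rewrite qE; case: t tT => // /Ts_nil.
rewrite IH//.
(* Now [g q] is a prefix of [u = g t] with [t] a prefix of [q], which forces [t = q]. *)
have : prefix (g q) (rcons u x) by rewrite -gs gpre// -cats1 prefix_prefix.
move=> /prefix_rconsP[gqE|gqu].
  have : g q = g (rcons q n) by rewrite gs.
  by move=> /(gI _ _ Tq sT)/(congr1 size); rewrite size_rcons => /n_Sn.
have [|t [tT gt tq]] := uT.
  by move=> u0; move: gqu; rewrite u0; case: (g q) (gfun _ Tq).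
have := tq; rewrite -gt; move: gqu; rewrite -gt gpre// => qt.
by move: qt tq => /prefixP[w1 ->] /prefixP[w2]; rewrite -catA => /esym/eqP;
  rewrite -{2}[q]cats0 eqseq_cat// eqxx /=; case: w1 => //=; rewrite cats0.
Qed.

End labelled_trees.

(** * Basic sequences *)

Section lincomb_lemmas.
Variables (R : realType) (X : completeNormedModType R).
Implicit Types (s : seq X) (a b : nat -> R) (f : {linear X -> R^o}).

Lemma lincombD a b s n :
  lincomb (fun i => a i + b i) s n = lincomb a s n + lincomb b s n.
Proof. by rewrite /lincomb -big_split; apply: eq_bigr => i _; rewrite scalerDl. Qed.

Lemma lincombZ t a s n : lincomb (fun i => t * a i) s n = t *: lincomb a s n.
Proof. by rewrite /lincomb scaler_sumr; apply: eq_bigr => i _; rewrite scalerA. Qed.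

Lemma lincomb_delta j s n : (j < n)%N ->
  lincomb (fun i => (i == j)%:R) s n = s`_j.
Proof.
move=> jn; rewrite /lincomb (bigD1_seq j) ?mem_index_iota ?iota_uniq//= eqxx scale1r.
by rewrite big1 ?addr0// => i /negPf ->; rewrite scale0r.
Qed.

Lemma linear_lincomb f a s n : f (lincomb a s n) = \sum_(0 <= i < n) a i * f s`_i.
Proof. by rewrite /lincomb linear_sum; apply: eq_bigr => i _; rewrite linearZ. Qed.

(** The l_1^+ estimate is exactly the domination required of the cone of nonnegative combinations;
    unit coefficient vectors recover the entries of [s]. *)
Lemma ell1p_sequence_functional K s : 0 < K -> ell1p_sequence K s ->
  exists2 f, dual_ball f & forall x, x \in s -> K^-1 <= f x.
Proof.
move=> K0 [_ _ sK].
have [||f f1 fC] := @dual_ball_above_cone _ _ [set vs | exists2 a : nat -> R,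
  (forall i, 0 <= a i) &
  vs = (lincomb a s (size s), K^-1 * \sum_(0 <= i < size s) a i)].
- split.
  + exists (fun=> 0) => //; congr (_, _); last by rewrite big1// mulr0.
    by rewrite /lincomb big1// => i _; rewrite scale0r.
  + move=> _ _ [a a0 ->] [b b0 ->]; exists (fun i => a i + b i).
      by move=> i; exact: addr_ge0.
    by congr (_, _); rewrite ?lincombD// big_split mulrDr.
  + move=> t _ _ t0 [a a0 [-> ->]]; exists (fun i => t * a i).
      by move=> i; rewrite mulr_ge0// ltW.
    by rewrite lincombZ -big_distrr /= mulrCA.
- by move=> _ _ [a a0 [-> ->]]; exact: sK a a0.
exists f => // x /(nthP 0)[j js <-].
rewrite -(lincomb_delta s js).
pose a (i : nat) : R := (i == j)%:R.
have : K^-1 * \sum_(0 <= i < size s) a i <= f (lincomb a s (size s)).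
  by apply: fC; exists a => // i; rewrite ler0n.
apply: le_trans; rewrite /a.
rewrite (bigD1_seq j) ?mem_index_iota ?iota_uniq//= eqxx big1 ?addr0 ?mulr1//.
by move=> i /negPf; rewrite /= => ->.
Qed.

End lincomb_lemmas.

(** * Mazur's argument *)

Section mazur.
Variables (R : realType) (X : completeNormedModType R).
Implicit Types (s : seq X) (a : nat -> R) (x : nat -> X) (f : {linear X -> R^o}).

Lemma lincomb_rcons a s v n : (n <= size s)%N ->
  lincomb a (rcons s v) n = lincomb a s n.
Proof.
move=> ns; rewrite /lincomb big_nat [RHS]big_nat; apply: eq_bigr => i /andP[_ ilt].
by rewrite nth_rcons (leq_trans ilt ns).
Qed.

Lemma lincomb_rcons_size a s v :
  lincomb a (rcons s v) (size s).+1 = lincomb a s (size s) + a (size s) *: v.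
Proof.
rewrite /lincomb big_nat_recr//= nth_rcons ltnn eqxx; congr (_ + _).
exact: lincomb_rcons.
Qed.

Lemma lincombS a s n : lincomb a s n.+1 = lincomb a s n + a n *: s`_n.
Proof. by rewrite /lincomb big_nat_recr. Qed.

Lemma interval_net (M h : R) : 0 < h ->
  exists G : seq R, forall t, `|t| <= M -> exists2 c, c \in G & `|t - c| <= h.
Proof.
move=> h0; exists [seq i%:R * h - M | i <- iota 0 (Num.trunc (2 * M / h)).+1] => t.
rewrite ler_norml => /andP[tM Mt].
have th0 : 0 <= (t + M) / h by rewrite divr_ge0 ?(ltW h0)//; lra.
have /andP[it ti] := truncn_itv th0.
have tle : (Num.trunc ((t + M) / h) <= Num.trunc (2 * M / h))%N.
  by rewrite le_truncn// ler_pM2r ?invr_gt0//; lra.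
move: (Num.trunc _) it ti tle => k it ti tle.
exists (k%:R * h - M); first by apply/mapP; exists k; rewrite // mem_iota /= add0n ltnS.
move: it ti; rewrite ler_pdivlMr// ltr_pdivrMr// -natr1 mulrDl mul1r => it ti.
by rewrite ler_norml; apply/andP; split; lra.
Qed.

(** Finite nets stand in for compactness in the span of [s]. *)
Lemma lincomb_net s (M e : R) : 0 < e ->
  exists N : seq X, forall a, (forall i, (i < size s)%N -> `|a i| <= M) ->
    exists2 z, z \in N & `|lincomb a s (size s) - z| <= e.
Proof.
elim/last_ind: s e => [|s v IH] e e0.
  exists [:: 0] => a _; exists 0; rewrite ?mem_head// /lincomb big_nil subrr normr0.
  exact: ltW.
have e2 : 0 < e / 2 by rewrite divr_gt0.
have v1 : 0 < `|v| + 1 by rewrite ltr_wpDl.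
have [N NP] := IH _ e2.
have [G GP] := interval_net M (divr_gt0 e2 v1).
exists [seq z + c *: v | z <- N, c <- G] => a; rewrite size_rcons => aM.
have [|z zN za] := NP a; first by move=> i si; apply: aM; exact: ltnW.
have [c cG ca] := GP _ (aM _ (ltnSn _)).
exists (z + c *: v); first by apply: allpairs_f.
rewrite lincomb_rcons_size opprD addrACA -scalerBl.
apply: le_trans (ler_normD _ _) _; rewrite [e]splitr lerD// normrZ.
have : `|a (size s) - c| * (`|v| + 1) <= e / 2 by rewrite -ler_pdivlMr.
by apply: le_trans; rewrite ler_wpM2l// lerDl.
Qed.

(** A single term is the difference of two consecutive initial projections. *)
Lemma basic_coef (C : R) s a i : 0 <= C -> (forall v, v \in s -> `|v| = 1) ->
  basic_le C s -> (i < size s)%N -> `|a i| <= 2 * C * `|lincomb a s (size s)|.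
Proof.
move=> C0 s1 [_ sC] si.
have -> : `|a i| = `|a i *: s`_i| by rewrite normrZ s1 ?mem_nth// mulr1.
have -> : a i *: s`_i = lincomb a s i.+1 - lincomb a s i.
  by rewrite lincombS addrAC subrr add0r.
apply: le_trans (ler_normB _ _) _.
by rewrite -mulrA mulr_natl mulr2n lerD// sC// ltnW.
Qed.

Lemma weakly_null_bound x f d : weakly_null x -> continuous f -> 0 < d ->
  exists N, forall n, (N <= n)%N -> `|f (x n)| < d.
Proof.
move=> wx fc d0; have /cvgr0Pnorm_lt/(_ d d0)[N _ NP] := wx f fc.
by exists N => n /NP.
Qed.

(** Far out, [x n] is almost annihilated by the norming functionals of a finite net for the unit
    sphere of the span of [s]. *)
Lemma mazur (C d : R) s x : 0 <= C -> (forall v, v \in s -> `|v| = 1) ->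
  basic_le C s -> weakly_null x -> (forall n, `|x n| = 1) -> 0 < d ->
  exists N, forall n, (N <= n)%N -> forall a t,
    (1 - d) * `|lincomb a s (size s)| <= `|lincomb a s (size s) + t *: x n|.
Proof.
move=> C0 s1 sC wx x1 d0; have e0 : 0 < d / 4 by rewrite divr_gt0.
have [Z ZP] := lincomb_net s (2 * C) e0.
have /choice[h hP] : forall z : X, exists f : {linear X -> R^o},
    dual_ball f /\ f z = `|z|.
  by move=> z; have [f f1 fz] := norming_functional z; exists f.
have [N NP] : exists N, forall n, (N <= n)%N ->
    forall z, z \in Z -> `|h z (x n)| < d / 4.
  elim: Z {ZP} => [|z Z [N NP]]; first by exists 0%N.
  have [N' N'P] := weakly_null_bound wx (proj1 (hP z).1) e0.
  exists (maxn N N') => n; rewrite geq_max => /andP[Nn N'n] z'.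
  by rewrite inE => /orP[/eqP->|]; [exact: N'P | exact: NP].
exists N => n /NP {}NP a t; set S := lincomb a s (size s).
have [->|S0] := eqVneq S 0; first by rewrite normr0 mulr0.
have nS : 0 < `|S| by rewrite normr_gt0.
pose a' i := `|S|^-1 * a i; pose S' := lincomb a' s (size s).
have S'E : S' = `|S|^-1 *: S by rewrite /S' lincombZ.
have S'1 : `|S'| = 1 by rewrite S'E normrZ normfV normr_id mulVf// gt_eqF.
suff H t' : 1 - d <= `|S' + t' *: x n|.
  rewrite -ler_pdivlMr// mulrC -[`|S|^-1]ger0_norm ?invr_ge0// -normrZ.
  by rewrite scalerDr scalerA -S'E.
(* A coefficient of size at least 2 leaves norm at least 1. Otherwise the functional of a nearby net
   point [z] loses [d / 4] for the norm of [z], [d / 4] for [S' - z] and [d / 2] for [x n]. *)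
have [t2|t2] := lerP 2 `|t'|.
  have := lerB_normD (t' *: x n) S'; rewrite normrZ x1 S'1 mulr1.
  by rewrite [_ *: _ + _]addrC; lra.
have [|z zZ Sz] := ZP a'.
  by move=> i si; have := basic_coef a' C0 s1 sC si; rewrite -/S' S'1 mulr1.
have [/dual_ballP hz hzz] := hP z.
apply: le_trans (hz _); apply: le_trans (ler_norm _).
have -> : h z (S' + t' *: x n) = h z z + h z (S' - z) + t' * h z (x n) :> R.
  by rewrite -linearD subrKC linearD linearZ.
have h1 := le_trans (hz (S' - z)) Sz.
have h2 : `|t' * h z (x n)| <= 2 * (d / 4).
  by rewrite normrM ler_pM// ltW// NP.
have h3 : 1 - d / 4 <= `|z|.
  have := lerB_normD S' (z - S'); rewrite subrKC S'1 distrC; lra.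
move: h1 h2; rewrite hzz !ler_norml => /andP[h1 _] /andP[h2 _]; lra.
Qed.

(** Projections onto shorter segments factor through the one onto [s], whose norm is at most
    [1 / (1 - d)]. *)
Lemma basic_le_rcons (C d : R) s v : 1 <= C -> d < 1 -> `|v| = 1 ->
  basic_le C s -> (forall a t,
    (1 - d) * `|lincomb a s (size s)| <= `|lincomb a s (size s) + t *: v|) ->
  0 <= d -> basic_le (C / (1 - d)) (rcons s v).
Proof.
move=> C1 d1 v1 [sindep sC] sv d0; have dp : 0 < 1 - d by rewrite subr_gt0.
split=> [a|a n]; rewrite size_rcons lincomb_rcons_size.
  move=> S0 i; have s0 : lincomb a s (size s) = 0.
    apply/eqP; rewrite -normr_le0 -(pmulr_rle0 _ dp).
    by apply: le_trans (sv a (a (size s))) _; rewrite S0 normr0.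
  rewrite ltnS leq_eqVlt => /orP[/eqP->|]; last exact: sindep.
  move: S0; rewrite s0 add0r => /(congr1 (fun z : X => `|z|)).
  by rewrite normrZ v1 mulr1 normr0 => /normr0P/eqP.
have Cd : 1 <= C / (1 - d) by rewrite ler_pdivlMr// mul1r; lra.
rewrite leq_eqVlt => /orP[/eqP->|ns].
  by rewrite lincomb_rcons_size ler_peMl.
rewrite lincomb_rcons//; apply: le_trans (sC a n ns) _.
rewrite -mulrA ler_wpM2l ?(le_trans _ C1)// mulrC ler_pdivlMr// mulrC.
exact: sv.
Qed.

End mazur.

(** * From weakly null trees to the Szlenk index *)

Section index_le_szlenk.
Variables (R : realType) (X : completeNormedModType R).
Variable fs : omega1 -> nat -> omega1.
Hypothesis hfs : fundamental fs.


Lemma countable_enum (S : set X) : countable S -> infinite_set S ->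
  exists y : nat -> X, set_bij [set: nat] S y.
Proof.
move=> cS iS; have /card_esym/card_set_bijP[y yP] : S #= [set: nat].
  exact: eq_card_nat.
by exists y.
Qed.

(** Infinitely many large siblings would make the set of siblings countably infinite; an enumeration
    of it is an [s_subsequence], hence weakly null, a contradiction. *)
Lemma weakly_null_tree_labels T a : weakly_null_tree fs T -> tree_iso T (Ts fs a) ->
  exists phi : seq nat -> X, set_bij (Ts fs a) T (labels phi) /\
    weakly_null_labels fs a phi.
Proof.
move=> [TT _ Tpar Twn] Tiso; have [phi phiP] := tree_iso_labels TT Tiso Tpar.
exists phi; split => // q f d fc d0.
have [phifun phiinj phisurj] := phiP.
set A := [set n | _]; apply: contrapT => Ainf.
pose B := [set n | Ts fs a (rcons q n)].
pose y0 n := phi (rcons q n).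
have yinj n m : B n -> B m -> y0 n = y0 m -> n = m.
  move=> Bn Bm ynm; suff /rcons_inj[] : rcons q n = rcons q m by [].
  by apply: phiinj; rewrite ?inE// !labels_rcons -/(y0 n) -/(y0 m) ynm.
have [n0 An0] := infinite_setN0 Ainf.
have Tq : labels phi q = [::] \/ T (labels phi q).
  by have [->|Tq] := Ts_rcons An0.1; [left | right; exact: phifun].
pose S := [set v | T (rcons (labels phi q) v)].
have SE : S = y0 @` B.
  apply/seteqP; split=> [v Sv|_ [n Bn <-]]; last first.
    by rewrite /S /= -labels_rcons; exact: phifun.
  have [s Ts_s] := phisurj _ Sv.
  case/lastP: s Ts_s => [/Ts_nil//|q' n] Ts_s.
  rewrite labels_rcons => /rcons_inj[qq vE].
  have {}qq : q' = q.
    have [q'0|Tq'] := Ts_rcons Ts_s.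
      move: qq; rewrite q'0 /= => /esym/(congr1 size); rewrite size_labels.
      by move=> /size0nil.
    have [q0|Tq0] := Ts_rcons An0.1.
      by move: qq; rewrite q0 => /(congr1 size); rewrite size_labels => /size0nil.
    by apply: phiinj => //; rewrite inE.
  by rewrite qq in Ts_s vE; exists n.
have [y yP] : exists y : nat -> X, set_bij [set: nat] S y.
  apply: countable_enum.
    by rewrite SE; apply: sub_countable (card_image_le _ _) _; exact: countableP.
  move=> Sfin; apply: Ainf.
  have : finite_set B.
    by apply: (@finite_inj_image _ _ y0) => [n m|]; [exact: yinj | rewrite -SE].
  by apply: sub_finite_set => n [].
have wy : weakly_null y by apply: Twn; exists (labels phi q).
have [N NP] := weakly_null_bound wy fc d0.
have [_ yyinj yysurj] := yP.
apply: Ainf; have : finite_set (y0 @` A).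
  apply: (@sub_finite_set _ _ (y @` `I_N)); last by apply: finite_image; exact: finite_II.
  move=> _ [n [Bn dn] <-]; have [|k _ yk] := yysurj (y0 n).
    by rewrite SE; exists n.
  exists k => //=; rewrite ltnNge; apply/negP => /NP; rewrite yk.
  by rewrite ltNge dn.
by apply: finite_inj_image => n m [Bn _] [Bm _]; exact: yinj.
Qed.

Lemma ell1p_index_sub_szlenk : separable X ->
  ell1p_weakly_null_index X fs `<=` @szlenk_index R X.
Proof.
move=> sepX b [K /= K1 [T [Twn TK]]].
have K0 : 0 < K by apply: lt_le_trans K1.
have Kc : 0 < K^-1 by rewrite invr_gt0.
have [TT [a a0 Tiso] _ _] := Twn.
rewrite (tree_order_iso hfs Tiso) => ba.
have [phi [[phifun _ _] phiwn]] := weakly_null_tree_labels Twn Tiso.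
have [||f Qf _] := labelled_tree_wder hfs (p := [::]) Kc phiwn.
- move=> s; case/lastP: s => [/Ts_nil//|q n] /phifun/TK[s1 _ _].
  by rewrite s1// labels_rcons mem_rcons mem_head.
- move=> s [->|/phifun/TK]; last exact: ell1p_sequence_functional.
  by have [g g1 _] := norming_functional (0 : X); exists g.
have d0 : 0 < K^-1 / 2 by rewrite divr_gt0.
(* One half is lost in [labelled_tree_wder], the other in [wder_sub_szlenk]. *)
exists (K^-1 / 2 / 2); first by rewrite /= divr_gt0.
exists a => //; exists f; exact: wder_sub_szlenk Qf.
Qed.

End index_le_szlenk.

(** * Extracting weakly null sequences *)

(** The recursion carries the current index and the largest threshold of the indices chosen so
    far. *)
Lemma sparse_subsequence (Q : nat -> nat -> Prop) N0 :
  (forall i, exists N, forall j, (N <= j)%N -> Q i j) ->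
  exists sg : nat -> nat, [/\ (N0 <= sg 0)%N, forall k, (sg k < sg k.+1)%N &
    forall i j, (i < j)%N -> Q (sg i) (sg j)].
Proof.
move=> /choice[b bP].
pose st := fix st k := if k is l.+1 then
    let n := maxn (st l).1.+1 (st l).2 in (n, maxn (st l).2 (b n))
  else (N0, b N0).
have lt1 k : ((st k).1 < (st k.+1).1)%N by rewrite /= leq_maxl.
have stb i k : (i <= k)%N -> (b (st i).1 <= (st k).2)%N.
  elim: k => [|k IH]; first by rewrite leqn0 => /eqP->.
  rewrite leq_eqVlt => /orP[/eqP->/=|/IH ik]; first exact: leq_maxr.
  by apply: leq_trans ik _; exact: leq_maxl.
exists (fun k => (st k).1); split => // i [//|j] ij.
by apply: bP; apply: leq_trans (stb i j ij) _; exact: leq_maxr.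
Qed.

Section extraction.
Variables (R : realType) (X : completeNormedModType R).
Implicit Types (p : seq X) (u w x : nat -> X) (f g h : {linear X -> R^o}).

Lemma weakly_null_ball x :
  (forall f, dual_ball f -> (fun n => f (x n) : R) @ \oo --> (0 : R)) ->
  weakly_null x.
Proof.
move=> x0 f fc.
have /linear_boundedP/pinfty_ex_gt0[r r0 rf] : bounded_near f (nbhs 0).
  exact/linear_bounded_continuous.
pose g : {linear X -> R^o} := r^-1 \*: f.
have gE y : g y = r^-1 * f y :> R by [].
have g1 : dual_ball g.
  by apply/dual_ballP => y; rewrite gE normrM normfV (gtr0_norm r0) ler_pdivrMl.
have fE n : f (x n) = r * g (x n) :> R by rewrite gE mulVKf// gt_eqF.
rewrite (_ : (fun n => _) = (fun n => r * g (x n) : R)); last exact/funext.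
by rewrite -[X in _ --> X](mulr0 r); apply: cvgM; [exact: cvg_cst | exact: x0].
Qed.

Lemma weak_star_near (f_ : nat -> {linear X -> R^o}) f y d : weak_star_cvg f_ f -> 0 < d ->
  exists N, forall n, (N <= n)%N -> `|f_ n y - f y| < d.
Proof.
by move=> /(_ y)/cvgrPdistC_lt h d0; have [N _ NP] := h d d0; exists N => n /NP.
Qed.

Lemma cvg_Cauchy_diff (v : R^nat) (m : nat -> nat) : cvgn v ->
  (forall k, (k <= m k)%N) -> (fun k => v (m k) - v k) @ \oo --> (0 : R).
Proof.
move=> cv mk; rewrite -(subrr (limn v)); apply: cvgB => //.
apply: cvg_comp cv; apply/cvgnyPge => A; exists A => // n /= An.
exact: leq_trans An (mk n).
Qed.

Hypothesis nl1 : ~ contains_ell1 X.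

(* Differences [u (m k) - u k] of a weakly Cauchy almost norming sequence are
   weakly null, and the functional with index [m k] hardly sees [u k]. *)
Lemma weakly_null_norming (f_ : nat -> {linear X -> R^o}) f e :
  (forall n, dual_ball (f_ n)) -> dual_ball f -> weak_star_cvg f_ f -> 0 < e ->
  (forall n, e < dual_norm (f_ n \- f)) ->
  exists (ps : nat -> nat) x, [/\ forall k, (k <= ps k)%N, forall k, `|x k| = 1,
    weakly_null x & forall k, e / 4 < f_ (ps k) (x k) - f (x k)].
Proof.
move=> f_1 f1 ff e0 fe.
have /choice[u uP] : forall n, exists y : X, `|y| <= 1 /\ e < f_ n y - f y.
  move=> n; have [v v1] := dual_norm_gt (fe n); rewrite /= ltr_normr => /orP[|] ve.
    by exists v.
  exists (- v); rewrite normrN; split => //; by rewrite !linearN -opprD.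
have [ph [phlt cu]] := rosenthal nl1 (fun n => (uP n).1).
have ph_ge k : (k <= ph k)%N.
  by elim: k => // k IH; apply: leq_ltn_trans IH (phlt _ _ (ltnSn k)).
pose w k := u (ph k).
have e2 : 0 < e / 2 by rewrite divr_gt0.
(* At [w k] the later functional is within [e / 2] of [f], so the difference [v k] keeps [e / 2] of
   the gap [e]; division by its norm, at most 2, leaves [e / 4]. *)
have /choice[m mP] : forall k, exists m, (k <= m)%N /\
    `|f_ (ph m) (w k) - f (w k)| < e / 2.
  move=> k; have [N NP] := weak_star_near (w k) ff e2.
  exists (maxn k N); rewrite leq_maxl; split => //; apply: NP.
  exact: leq_trans (leq_maxr k N) (ph_ge _).
pose v k := w (m k) - w k.
have fv k : e / 2 < f_ (ph (m k)) (v k) - f (v k).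
  have := (uP (ph (m k))).2; have := (mP k).2; rewrite /v !linearB /=.
  rewrite ltr_norml => /andP[? ?] ?; rewrite /w in mP *; lra.
have v2 k : `|v k| <= 2.
  apply: le_trans (ler_normB _ _) _.
  have := (uP (ph (m k))).1; have := (uP (ph k)).1; rewrite /w; lra.
(* Norms bounded away from 0 keep the normalized differences weakly null. *)
have ve k : e / 4 <= `|v k|.
  have := dual_ball_diff (v k) (f_1 (ph (m k))) f1.
  have := fv k; have := ler_norm (f_ (ph (m k)) (v k) - f (v k)); lra.
have v0 k : 0 < `|v k| by apply: lt_le_trans (ve k); rewrite divr_gt0.
exists (fun k => ph (m k)), (fun k => `|v k|^-1 *: v k); split.
- by move=> k; apply: leq_trans (mP k).1 (ph_ge _).
- by move=> k; rewrite normrZ normfV normr_id mulVf// gt_eqF.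
- apply: weakly_null_ball => g g1.
  have gv : (fun k => g (v k) : R) @ \oo --> (0 : R).
    rewrite (_ : (fun k => _) = (fun k => g (w (m k)) - g (w k) : R)).
      by apply: (@cvg_Cauchy_diff (fun k => g (w k) : R)) => [|k]; [exact: cu | case: (mP k)].
    by apply: funext => k; rewrite linearB.
  apply/cvgrPdistC_lt => d d0.
  have de : 0 < d * (e / 4) by rewrite mulr_gt0// divr_gt0.
  move/cvgrPdistC_lt : gv => /(_ _ de); apply: filterS => k; rewrite !subr0 => gk.
  rewrite linearZ normrM normfV normr_id ltr_pdivrMl//.
  by apply: lt_le_trans gk _; rewrite mulrC ler_wpM2r// ltW.
- move=> k; have xE g : g (`|v k|^-1 *: v k) = `|v k|^-1 * g (v k) :> R.
    by rewrite linearZ.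
  rewrite !xE -mulrBr [ltRHS]mulrC ltr_pdivlMr//; apply: le_lt_trans (fv k).
  have : e / 4 * `|v k| <= e / 4 * 2 by rewrite ler_wpM2l// ltW// divr_gt0.
  lra.
Qed.

(** Since [e / 4 = 2 * c] and [f (x k)] tends to 0, eventually [f_ (ps k) (x k) > c]. The strict
    bounds on [p] persist under weak* convergence, so discarding finitely many terms gives
    everything. *)
Lemma extraction (f_ : nat -> {linear X -> R^o}) f e c C p :
  (forall n, dual_ball (f_ n)) -> dual_ball f -> weak_star_cvg f_ f -> 0 < e ->
  (forall n, e < dual_norm (f_ n \- f)) -> c = e / 8 ->
  1 <= C < 2 -> (forall v, v \in p -> `|v| = 1) -> basic_le C p ->
  (forall v, v \in p -> c < f v) ->
  exists (ps : nat -> nat) x,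
    [/\ forall k, (k <= ps k)%N,
        (forall g d, continuous g -> 0 < d ->
           exists N, forall n, (N <= n)%N -> `|g (x n)| < d),
        forall k l, x k = x l -> k = l &
        forall k, [/\ forall v, v \in rcons p (x k) -> `|v| = 1,
          forall v, v \in rcons p (x k) -> c < f_ (ps k) v &
          exists2 C', 1 <= C' < 2 & basic_le C' (rcons p (x k))]].
Proof.
move=> f_1 f1 ff e0 fe cE /andP[C1 C2] p1 pC pf.
have [ps [x [psge x1 wx xe]]] := weakly_null_norming f_1 f1 ff e0 fe.
(* With this [d] the new constant [C / (1 - d)] equals [4 * C / (2 + C)], still below 2. *)
pose d := (2 - C) / 4; have d0 : 0 < d by rewrite divr_gt0// subr_gt0.
have [N1 N1P] := mazur (le_trans ler01 C1) p1 pC wx x1 d0.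
have c0 : 0 < c by rewrite cE divr_gt0.
have [N2 N2P] := weakly_null_bound wx (proj1 f1) c0.
have [N3 N3P] : exists N, forall n, (N <= n)%N -> forall v, v \in p -> c < f_ n v.
  elim: p {p1 pC N1P} pf => [_|v p IH pf]; first by exists 0%N.
  have [|N NP] := IH; first by move=> w wp; apply: pf; rewrite inE wp orbT.
  have fv : 0 < f v - c by rewrite subr_gt0 pf// mem_head.
  have [N' N'P] := weak_star_near v ff fv.
  exists (maxn N N') => n; rewrite geq_max => /andP[Nn N'n] w.
  rewrite inE => /orP[/eqP->|]; last exact: NP.
  by have := N'P n N'n; rewrite ltr_norml => /andP[? ?]; lra.
(* Distinct terms are needed for distinct siblings: the norming functional of [x i] is 1 there but
   tends to 0 along [x]. *)
have [|sg [sg0 sgS sgx]] := @sparse_subsequence (fun i j => x j <> x i)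
    (maxn N1 (maxn N2 N3)).
  move=> i; have [g g1 gx] := norming_functional (x i).
  have [N NP] := weakly_null_bound wx (proj1 g1) ltr01.
  by exists N => j /NP + ji; rewrite ji gx x1 normr1 ltxx.
have sg_ge k : (k <= sg k)%N by elim: k => // k IH; exact: leq_ltn_trans IH (sgS k).
have sgN k : (maxn N1 (maxn N2 N3) <= sg k)%N.
  by elim: k => // k IH; exact: leq_trans IH (ltnW (sgS k)).
exists (fun k => ps (sg k)), (fun k => x (sg k)); split.
- by move=> k; apply: leq_trans (sg_ge k) (psge _).
- move=> g r gc r0; have [N NP] := weakly_null_bound wx gc r0.
  by exists N => n Nn; apply: NP; exact: leq_trans Nn (sg_ge n).
- move=> k l xkl; case: (ltngtP k l) => // /sgx; rewrite xkl; exact.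
- move=> k; move: (sgN k); rewrite !geq_max => /and3P[Nk1 Nk2 Nk3]; split.
  + by move=> v; rewrite mem_rcons inE => /orP[/eqP->|/p1].
  + move=> v; rewrite mem_rcons inE => /orP[/eqP->|vp].
      have := xe (sg k); have := N2P _ Nk2; rewrite ltr_norml => /andP[? ?]; lra.
    by apply: N3P => //; apply: leq_trans Nk3 (psge _).
  + have d1 : d < 1 by rewrite /d; lra.
    exists (C / (1 - d)); last first.
      by apply: basic_le_rcons => //; [exact: N1P | exact: ltW].
    by rewrite ler_pdivlMr ?subr_gt0// ltr_pdivrMr ?subr_gt0// /d; apply/andP; split; lra.
Qed.

End extraction.

(** * From the Szlenk index to weakly null trees *)

Section szlenk_le_index.
Variables (R : realType) (X : completeNormedModType R).
Variable fs : omega1 -> nat -> omega1.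
Hypothesis hfs : fundamental fs.
Implicit Types (f g : {linear X -> R^o}) (p : seq X) (phi : seq nat -> X).

(** Halving [eps] and dropping an initial part turns the lower limit into a strict bound on all
    terms. *)
Lemma szlenk_step_seq eps P f : 0 < eps -> szlenk_step eps P f ->
  exists f_ : nat -> {linear X -> R^o}, [/\ forall n, P (f_ n),
    weak_star_cvg f_ f & forall n, eps / 2 < dual_norm (f_ n \- f)].
Proof.
move=> eps0 [f1 [f_ [Pf ff fe]]].
have e2 : ((eps / 2)%:E < limn_einf (fun m => (dual_norm (f_ m \- f))%:E))%E.
  by apply: lt_le_trans fe; rewrite lte_fin; lra.
have [N NP] : exists N, forall n, (N <= n)%N -> eps / 2 < dual_norm (f_ n \- f).
  move: e2; rewrite limn_einf_lim.
  move/cvg_lim: (@cvg_einfs_sup R (fun m => (dual_norm (f_ m \- f))%:E)) => -> //.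
  move=> /ereal_sup_gt[_ [N _ <-]] eN; exists N => n Nn.
  by rewrite -lte_fin; apply: lt_le_trans eN _; apply: ereal_inf_lbound; exists n.
exists (fun n => f_ (N + n)%N); split => // [x|n]; last by apply: NP; rewrite leq_addr.
apply/cvgrPdistC_lt => d d0; have [M MP] := weak_star_near x ff d0.
by exists M => // n /= Mn; apply: MP; apply: leq_trans Mn (leq_addl _ _).
Qed.

(* Injectivity of [j] and the last clause let one sequence [f_], hence one weakly
   null sequence of initial nodes, serve all the copies of a limit tree. *)
Lemma szlenk_set_children eps a f : separable X -> 0 < eps -> ~ is_zero a ->
  szlenk_set eps a f ->
  exists (root : set nat) (be : nat -> omega1) (j : nat -> nat)
      (f_ : nat -> {linear X -> R^o}),
    [/\ forall N s, Ts fs a (N :: s) <->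
          root N /\ (s = [::] \/ Ts fs (be N) s),
        forall N, root N -> (be N < a)%O,
        forall M N, root M -> root N -> j M = j N -> M = N,
        forall n, dual_ball (f_ n) &
        [/\ weak_star_cvg f_ f, forall n, eps / 2 < dual_norm (f_ n \- f) &
            forall N i, root N -> (j N <= i)%N -> szlenk_set eps (be N) (f_ i)]].
Proof.
move=> sepX eps0 a0 Pf; have f1 := szlenk_set_ball Pf.
case: (zero_succ_limit a) => [//|[b ba]|la].
  have [|f_ [Pf_ ff fe]] := @szlenk_step_seq eps (szlenk_set eps b) f eps0.
    by move: Pf; rewrite /szlenk_set (titerS _ _ ba).
  exists setT, (fun=> b), id, f_; split => //.
  - by move=> N s; rewrite (Ts_succE _ _ _ ba); split => [|[]].
  - by move=> N _; exact: ba.1.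
  - by move=> n; exact: szlenk_set_ball (Pf_ n).
have [fsS _ fsa fsb] := hfs la.
have [ga gaP] := choice fsS.
have ga_mono m n : (m <= n)%N -> (ga m <= ga n)%O.
  move=> mn; apply: osucc_le (gaP n) _.
  exact: lt_le_trans (gaP m).1 (fundamental_mono hfs la mn).
have [d dd] := dense_seq sepX.
(* One functional is taken from each stage [ga n], near [f] on the first [n] dense points, so that
   together they converge to [f]. *)
have /choice[f_ f_P] : forall n, exists g, [/\ szlenk_set eps (ga n) g,
    near_on (mkseq d n) n.+1%:R^-1 g f & eps / 2 < dual_norm (g \- f)].
  move=> n; have [|g_ [Pg gf ge]] := @szlenk_step_seq eps (szlenk_set eps (ga n)) f eps0.
    move: Pf; rewrite /szlenk_set titer_lim// => /(_ _ (fsa n)).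
    by rewrite (titerS _ _ (gaP n)).
  have n0 : 0 < n.+1%:R^-1 :> R by rewrite invr_gt0.
  have [N NP] : exists N, forall i, (N <= i)%N -> near_on (mkseq d n) n.+1%:R^-1 (g_ i) f.
    elim: (mkseq d n) => [|x l [N NP]]; first by exists 0%N.
    have [N' N'P] := weak_star_near x gf n0.
    exists (maxn N N') => i; rewrite geq_max => /andP[Ni N'i] y.
    by rewrite inE => /orP[/eqP->|]; [exact: N'P | exact: NP].
  by exists (g_ N); split => //; exact: NP.
pose dec N : nat * nat := odflt (0, 0)%N (unpickle N).
have decK (n k : nat) : dec (pickle (n, k)) = (n, k) by rewrite /dec pickleK.
(* The sequence code is injective and exceeds its entries: an index past the code of [(n, k)] is
   past [n], hence in a stage beyond [ga n]. *)
exists (fun N => exists n k : nat, N = pickle (n, k)), (fun N => ga (dec N).1),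
  (fun N => CodeSeq.code [:: (dec N).1; (dec N).2]), f_.
clearbody dec; split.
- move=> N s; split => [/(Ts_limitE _ _ la)[n [k [t [[-> ->]]]]]|].
    rewrite decK (Ts_succE _ _ _ (gaP n)) => h; split => //; by exists n, k.
  move=> [[n [k ->]]]; rewrite decK => h; apply: Ts_limit => //.
  by apply/(Ts_succE _ _ _ (gaP n)).
- by move=> N _; exact: lt_trans (gaP _).1 (fsa _).
- move=> M N [m [k ->]] [n [l ->]]; rewrite !decK.
  by move=> /(can_inj CodeSeq.codeK)[-> ->].
- by move=> n; case: (f_P n) => /szlenk_set_ball.
- split.
  + apply: (weak_star_cvg_dense dd) => // n; last by case: (f_P n).
    by case: (f_P n) => /szlenk_set_ball.
  + by move=> n; case: (f_P n).
  + move=> N i [n [k ->]]; rewrite decK => ji.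
    have [Pi _ _] := f_P i; apply: szlenk_set_decreasing Pi; apply: ga_mono.
    apply: leq_trans ji; apply: ltnW.
    by have /= /andP[] := CodeSeq.ltn_code [:: n; k].
Qed.

Definition injective_labels a phi : Prop := forall q n m,
  Ts fs a (rcons q n) -> Ts fs a (rcons q m) ->
  phi (rcons q n) = phi (rcons q m) -> n = m.

Definition good_branch (c : R) p : Prop :=
  [/\ forall v, v \in p -> `|v| = 1, basic_le 2 p &
      exists2 g : {linear X -> R^o}, dual_ball g & forall v, v \in p -> c < g v].

(** The induction carries the branch [p] chosen so far, a basis constant [C] still below 2 and a
    functional [f] large on [p]. The factor 16 is 2 from [szlenk_step_seq] times 8 from
    [extraction]. *)
Lemma szlenk_labelled_tree eps a f C p : separable X -> ~ contains_ell1 X ->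
  0 < eps -> szlenk_set eps a f -> 1 <= C < 2 ->
  (forall v, v \in p -> `|v| = 1) -> basic_le C p ->
  (forall v, v \in p -> eps / 16 < f v) ->
  exists phi, [/\ weakly_null_labels fs a phi, injective_labels a phi &
    forall s, s = [::] \/ Ts fs a s -> good_branch (eps / 16) (p ++ labels phi s)].
Proof.
move=> sepX nl1 eps0; elim/(well_founded_ind omega1_wf) : a f C p.
move=> a IH f C p Pf C12 p1 pC pf.
have f1 := szlenk_set_ball Pf.
have good_p : good_branch (eps / 16) p.
  split => //; last by exists f.
  case/andP: C12 => _ C2; case: pC => indep pC; split => // b n np.
  by apply: le_trans (pC b n np) _; rewrite ler_wpM2r// ltW.
case: (pselect (is_zero a)) => [a0|a0].
  have nT s : ~ Ts fs a s by exact: Ts_zero.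
  exists (fun=> 0); split.
  - move=> q g d _ _; rewrite (_ : [set n | _] = set0); first exact: finite_set0.
    by apply/seteqP; split => // n [/nT].
  - by move=> q n m /nT.
  - by move=> s [->|/nT//]; rewrite cats0.
have [root [be [j [f_ [TsE be_a jinj f_1 [ff fe Pf_]]]]]] :=
  szlenk_set_children sepX eps0 a0 Pf.
have e2 : 0 < eps / 2 by rewrite divr_gt0.
have [|ps [x [psge xnull xinj xP]]] :=
  extraction nl1 f_1 f1 ff e2 fe (c := eps / 16) _ C12 p1 pC pf; first by lra.
(* As [ps (j N) >= j N], the functional attached to [y N] lies in stage [be N], ready for the
   induction hypothesis. *)
pose y N := x (j N).
have /choice[ch chP] : forall N, exists phi, root N ->
    [/\ weakly_null_labels fs (be N) phi, injective_labels (be N) phi &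
      forall s, s = [::] \/ Ts fs (be N) s ->
        good_branch (eps / 16) (rcons p (y N) ++ labels phi s)].
  move=> N; case: (pselect (root N)) => [rN|nrN]; last by exists (fun=> 0).
  have [xn1 xf [C' C'12 xC']] := xP (j N).
  have [phi phiP] := IH _ (be_a N rN) _ C' _ (Pf_ N _ rN (psge _)) C'12 xn1 xC' xf.
  by exists phi.
pose phi s := if s is N :: s' then if s' is [::] then y N else ch N s' else 0.
have phiE N s : s <> [::] -> phi (N :: s) = ch N s by case: s.
have phi1 N : phi [:: N] = y N by [].
clearbody phi.
have TsN N q n : Ts fs a (N :: rcons q n) -> root N /\ Ts fs (be N) (rcons q n).
  by move=> /TsE[rN [|//]]; case: q.
have rconsN0 q (n : nat) : rcons q n <> [::] by case: q.
exists phi; split.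
- move=> [|N q] g d gc d0.
    have [M MP] := xnull g d gc d0.
    have : finite_set `I_M by exact: finite_II.
    move=> fM; apply: (@finite_inj_image _ _ j).
      by move=> m n [/TsE[rm _] _] [/TsE[rn _] _]; exact: jinj.
    apply: sub_finite_set fM => _ [n [_ dn] <-]; move: dn; rewrite /= phi1 => dn.
    by rewrite ltnNge; apply/negP => /MP; rewrite ltNge dn.
  case: (pselect (root N)) => [rN|nrN]; last first.
    rewrite (_ : [set n | _] = set0); first exact: finite_set0.
    by apply/seteqP; split => // n [/TsE[]].
  have [wn _ _] := chP N rN; apply: sub_finite_set (wn q g d gc d0) => n /=.
  by rewrite phiE// => -[/TsN[_ Tn] dn].
- move=> [|N q] n m /=.
    by move=> /TsE[rn _] /TsE[rm _]; rewrite !phi1 => /xinj /jinj; exact.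
  rewrite !phiE// => /TsN[rN Tn] /TsN[_ Tm].
  by have [_ inj _] := chP N rN; exact: inj.
- move=> [_|N s [//|/TsE[rN sT]]]; first by rewrite cats0.
  have [_ _ /(_ s sT)] := chP N rN; rewrite cat_rcons /= phi1.
  by rewrite (@eq_labels _ (ch N) (fun t => phi (N :: t))) // => t t0; rewrite phiE.
Qed.

Lemma injective_labels_inj a phi s t : injective_labels a phi ->
  (s = [::] \/ Ts fs a s) -> (t = [::] \/ Ts fs a t) ->
  labels phi s = labels phi t -> s = t.
Proof.
move=> inj; elim/last_ind: s t => [|s n IH] t sT tT st.
  by move: st => /esym/(congr1 size); rewrite size_labels => /size0nil.
case/lastP: t tT st => [|t m] tT.
  by move=> /(congr1 size); rewrite !size_labels size_rcons.
have {}sT : Ts fs a (rcons s n) by case: sT => //; case: (s).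
have {}tT : Ts fs a (rcons t m) by case: tT => //; case: (t).
rewrite !labels_rcons => /rcons_inj[st snm].
have {}st := IH _ (Ts_rcons sT) (Ts_rcons tT) st; subst s.
by congr rcons; exact: inj sT tT snm.
Qed.

Lemma labels_tree_iso a phi : injective_labels a phi ->
  tree_iso (labels phi @` Ts fs a) (Ts fs a).
Proof.
move=> inj; apply: tree_iso_sym; exists (labels phi); split.
  split=> [s sT|s t /set_mem sT /set_mem tT|_ [s sT <-]]; [by exists s| |by exists s].
  by apply: injective_labels_inj inj _ _; right.
move=> s t sT tT; apply/idP/idP => [st|/prefixP[w ->]]; last first.
  rewrite -{1}(@take_size_cat _ (size s) s w erefl) -take_labels.
  by apply/prefixP; exists (drop (size s) (labels phi (s ++ w))); rewrite cat_take_drop.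
have : labels phi s = labels phi (take (size s) t).
  rewrite -take_labels; move: st => /prefixP[w ->].
  by rewrite take_size_cat// size_labels.
case: s sT st => [/Ts_nil//|n s] sT st.
move=> /(injective_labels_inj inj (or_intror sT) _) ->; last first.
  by right; exact: Ts_prefix tT _.
exact: prefix_take.
Qed.

(** Converse of [weakly_null_tree_labels]: an [s_subsequence] visits each sibling once, so finitely
    many large siblings mean finitely many large terms. *)
Lemma weakly_null_tree_of_labels a phi : ~ is_zero a -> injective_labels a phi ->
  weakly_null_labels fs a phi -> weakly_null_tree fs (labels phi @` Ts fs a).
Proof.
move=> a0 inj wn; split.
- split; first by have [s sT] := Ts_nonempty hfs a0; exists (labels phi s), s.
  by move=> [[|n s] sT //=]; move: sT => /Ts_nil.
- by exists a => //; exact: labels_tree_iso.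
- move=> p v p0 [s sT]; case/lastP: s sT => [/Ts_nil//|q n] sT.
  rewrite labels_rcons => /rcons_inj[qp _]; have [q0|Tq] := Ts_rcons sT.
    by case: p0; rewrite -qp q0.
  by exists q.
- move=> y [p pT [yfun yinj _]] f fc.
  have [q qT qp] : exists2 q, q = [::] \/ Ts fs a q & labels phi q = p.
    by case: pT => [->|[q Tq <-]]; [exists [::]; first by left | exists q; first by right].
  have /choice[n nP] : forall k, exists n, Ts fs a (rcons q n) /\ y k = phi (rcons q n).
    move=> k; have [s sT] := yfun k I.
    case/lastP: s sT => [/Ts_nil//|q' n] sT; rewrite labels_rcons => /rcons_inj[qq yk].
    exists n; have <- : q' = q; last by split.
    by apply: (injective_labels_inj inj) => //; [exact: Ts_rcons sT | rewrite qq].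
  apply/cvgrPdistC_lt => d d0.
  have [N NP] : exists N, forall k, [set k | d <= `|f (y k)|] k -> (k < N)%N.
    apply: finite_nat_bound; apply: (@finite_inj_image _ _ n).
      move=> k l _ _ kl; apply: yinj; rewrite ?inE//.
      by rewrite (nP k).2 (nP l).2 kl.
    apply: sub_finite_set (wn q f d fc d0) => _ [k /= dk <-].
    by split; [exact: (nP k).1 | rewrite -(nP k).2].
  exists N => // k /= Nk; rewrite subr0 ltNge; apply/negP => /NP.
  by rewrite ltnNge Nk.
Qed.

Lemma good_branch_ell1p c K p : 0 < c -> 2 <= K -> K^-1 <= c ->
  good_branch c p -> ell1p_sequence K p.
Proof.
move=> c0 K2 Kc [p1 [indep p2] [g /dual_ballP g1 gp]]; split => //.
  split => // a n np; apply: le_trans (p2 a n np) _; exact: ler_wpM2r.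
move=> a a0; apply: le_trans (g1 _); apply: le_trans (ler_norm _).
rewrite linear_lincomb mulr_sumr big_nat [leRHS]big_nat.
apply: ler_sum => i /andP[_ ip]; rewrite mulrC ler_wpM2l//.
by apply: le_trans Kc _; apply: ltW; apply: gp; exact: mem_nth.
Qed.

Lemma szlenk_sub_ell1p_index : separable X -> ~ contains_ell1 X ->
  @szlenk_index R X `<=` ell1p_weakly_null_index X fs.
Proof.
move=> sepX nl1 b [eps /= eps0 [a [f Pf] /= ba]].
have a0 : ~ is_zero a by move=> /(_ b).
have [||||phi [wn inj good]] := @szlenk_labelled_tree eps a f 1 [::] sepX nl1 eps0 Pf.
- by rewrite lexx ltr1n.
- by [].
- split=> // c n; rewrite leqn0 => /eqP->.
  by rewrite /lincomb big_nil normr0 mulr0.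
- by [].
have c0 : 0 < eps / 16 by rewrite divr_gt0.
(* The 2 covers the basis constant, the other term the lower l_1^+ estimate. *)
exists (Num.max 2 (eps / 16)^-1); first by rewrite /= le_max; apply/orP; left; lra.
exists (labels phi @` Ts fs a).
  split; first exact: weakly_null_tree_of_labels.
  move=> _ [s sT <-]; apply: (good_branch_ell1p c0); first by rewrite le_max lexx.
    rewrite -[leRHS]invrK lef_pV2 ?posrE ?invr_gt0//; first by rewrite le_max lexx orbT.
    by rewrite lt_max ltr0n.
  by apply: good; right.
by rewrite (tree_order_iso hfs (labels_tree_iso inj)).
Qed.

End szlenk_le_index.

Theorem theorem4p2 (R : realType) (X : completeNormedModType R)
    (fs : omega1 -> nat -> omega1) (hfs : fundamental fs)
    (hsep : separable X) (hl1 : ~ contains_ell1 X) :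
  szlenk_index X = ell1p_weakly_null_index X fs.
Proof.
apply/seteqP; split; first exact: szlenk_sub_ell1p_index.
exact: ell1p_index_sub_szlenk.
Qed.
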